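(* There exists a spherical tetrahedron $T\subset\mathbb{S}^3$ all of whose dihedral angles are rational multiples of $\pi$, whose volume belongs to $\pi^2\,\mathbb{Q}$, and which is not decomposable into any finite number of spherical Coxeter tetrahedra.
   Context: A spherical tetrahedron is the intersection of a simplicial cone in $\mathbb{R}^4$ with apex at the origin (with dihedral angles in $(0,\pi)$) with the unit sphere $\mathbb{S}^3\subset\mathbb{R}^4$; its dihedral angles are those of the cone. Volume is taken with respect to the standard metric of constant curvature $+1$, so $\mathrm{Vol}\,\mathbb{S}^3=2\pi^2$. A spherical Coxeter tetrahedron is a spherical tetrahedron whose six dihedral angles are all of the form $\pi/n$ with integers $n\ge 2$ (possibly different for different edges). A spherical tetrahedron $T$ is decomposable into a finite number of spherical Coxeter tetrahedra if it is a union of finitely many spherical Coxeter tetrahedra (not necessarily isometric to each other) with pairwise disjoint interiors. *)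

(* Defs.v *)
From HB Require Import structures.
From mathcomp Require Import all_boot all_order all_algebra.
From mathcomp Require Import all_classical all_reals all_analysis.

Set Implicit Arguments.
Unset Strict Implicit.
Unset Printing Implicit Defensive.

Import Order.TTheory GRing.Theory Num.Theory.
Import numFieldNormedType.Exports.

Local Open Scope classical_set_scope.
Local Open Scope ring_scope.

(* The norm [`|x|] that MathComp-Analysis puts on 'rV[R]_n is the sup norm (it
   is used below only for its topology), hence an explicit Euclidean
   structure. *)
Definition dot {R : realType} {n : nat} (u v : 'rV[R]_n) : R :=
  \sum_(i < n) u 0 i * v 0 i.

Definition enorm {R : realType} {n : nat} (u : 'rV[R]_n) : R :=
  Num.sqrt (dot u u).

Definition angle {R : realType} {n : nat} (u v : 'rV[R]_n) : R :=
  acos (dot u v / (enorm u * enorm v)).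

Definition sphere3 {R : realType} : set 'rV[R]_4 := [set x | enorm x = 1].

(* The cone with apex 0 generated by the rows of V; it is a simplicial cone
   when V is invertible. *)
Definition cone {R : realType} (V : 'M[R]_4) : set 'rV[R]_4 :=
  [set x | exists a : 'rV[R]_4, (forall i, 0 <= a 0 i) /\ x = a *m V].

Definition tetrahedron {R : realType} (V : 'M[R]_4) : set 'rV[R]_4 :=
  cone V `&` @sphere3 R.

(* The i-th vector of the basis dual to the rows of V. It is orthogonal to the
   facet of the cone spanned by the rows other than row i, and points to the
   side of that facet containing row i. *)
Definition inner_normal {R : realType} (V : 'M[R]_4) (i : 'I_4) : 'rV[R]_4 :=
  row i (invmx V)^T.

Lemma dot_inner_normal (R : realType) (V : 'M[R]_4) (i k : 'I_4) :
  V \in unitmx -> dot (row k V) (inner_normal V i) = (k == i)%:R.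
Proof.
move=> uV; have /matrixP/(_ k i) := mulmxV uV.
rewrite !mxE => <-; apply: eq_bigr => j _.
by rewrite !mxE.
Qed.

(* The dihedral angle between the facets opposite to the rows i and j (i != j),
   that is, along the edge of the tetrahedron joining the two other vertices. *)
Definition dihedral {R : realType} (V : 'M[R]_4) (i j : 'I_4) : R :=
  pi - angle (inner_normal V i) (inner_normal V j).

Definition rational_angles {R : realType} (V : 'M[R]_4) : Prop :=
  forall i j : 'I_4, i != j -> exists q : rat, dihedral V i j = ratr q * pi.

Definition coxeter {R : realType} (V : 'M[R]_4) : Prop :=
  V \in unitmx /\
  forall i j : 'I_4, i != j ->
    exists n : nat, (2 <= n)%N /\ dihedral V i j = pi / n%:R.

Definition lebesgue4 {R : realType} : set (R * (R * (R * R))) -> \bar R :=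
  (@lebesgue_measure R \x
    (@lebesgue_measure R \x (@lebesgue_measure R \x @lebesgue_measure R)))%E.

Definition pack4 {R : realType} (x : 'rV[R]_4) : R * (R * (R * R)) :=
  (x 0 (inord 0), (x 0 (inord 1), (x 0 (inord 2), x 0 (inord 3)))).

Definition sector {R : realType} (A : set 'rV[R]_4) : set 'rV[R]_4 :=
  [set x | exists (r : R) (u : 'rV[R]_4),
    [/\ 0 <= r, r <= 1, A u & x = r *: u]].

(* The volume of a (Borel) subset of the unit 3-sphere for the round metric.
   In polar coordinates dx = r^3 dr dvol, so that the solid sector over A of
   radius 1 has Lebesgue measure vol(A) / 4; thus the whole sphere has volume
   4 * (pi^2 / 2) = 2 * pi^2. *)
Definition sphere_vol {R : realType} (A : set 'rV[R]_4) : \bar R :=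
  (4%:R%:E * lebesgue4 (pack4 @` sector A))%E.

(* Topological interior relative to the 3-sphere. *)
Definition sphere_interior {R : realType} (A : set 'rV[R]_4) : set 'rV[R]_4 :=
  @interior (subspace (@sphere3 R)) A.

Definition coxeter_decomposable {R : realType} (T : set 'rV[R]_4) : Prop :=
  exists (m : nat) (W : 'I_m -> 'M[R]_4),
    [/\ forall k, coxeter (W k),
        T = \bigcup_(k in [set: 'I_m]) tetrahedron (W k) &
        forall k l, k != l ->
          sphere_interior (tetrahedron (W k)) `&`
          sphere_interior (tetrahedron (W l)) = set0].

(* Main.v *)
(* T is the join of a point e with a right spherical triangle ABC of angles
   pi / 6 at A, pi / 2 at B and 2 pi / 5 at C in the sphere polar to e. Reflections
   preserve the volume, so the volume of a wedge is proportional to its angle,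
   and Girard's inclusion-exclusion of lunes computes the volume of T. If Coxeter
   tetrahedra inside T cover T, one of them has an edge on the edge eA, with a
   dihedral angle at most pi / 6. A positive definite Gram matrix of a Coxeter
   tetrahedron with such an angle forces its opposite edge to be polar to the edge
   eA; but AB and AC are shorter than pi / 2, so no point of T is polar to eA. *)
Require Import Defs.
From HB Require Import structures.
From mathcomp Require Import all_boot all_order all_algebra.
From mathcomp Require Import all_classical all_reals all_analysis.
From mathcomp Require Import measurable_realfun.
From mathcomp Require Import ring lra.

Set Implicit Arguments.
Unset Strict Implicit.
Unset Printing Implicit Defensive.

Import Order.TTheory GRing.Theory Num.Theory.
Import numFieldNormedType.Exports.

Local Open Scope classical_set_scope.
Local Open Scope ring_scope.

(** * Maps preserving a product measure *)

(** The constants sit on two thresholds. The cosine of an angle pi / n is 0 or at least 1/2. If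
    three normals of a Coxeter cone have one angle at most pi / 6 and a second cosine at least 1/2,
    their Gram determinant is at most 1 - 3/4 - 1/4 = 0; so pi / 6 is just small enough to force
    right angles at the adjacent edges. The angle 2 pi / 5 exceeds pi / 3, which makes the angle sum
    of ABC exceed pi, and is less than pi / 2, the value at which AB and AC would reach length pi /
    2 and T itself would be Coxeter. On the volume side the measure is an iterated product of
    Lebesgue measures on the line, so its invariance under reflections is derived from Fubini
    applied to shears. The ball is the only body whose volume is integrated explicitly. As the
    angles are rational, equal wedges fill a halfspace exactly and no limit is taken. *)

Definition preserves {R : realType} d (T : measurableType d)
    (m : set T -> \bar R) (f : T -> T) : Prop :=
  measurable_fun setT f /\
  forall A, measurable A -> m (f @^-1` A) = m A.

Section preserves_lemmas.
Context (R : realType).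

Lemma preserves_comp d (T : measurableType d) (m : set T -> \bar R)
    (f g : T -> T) :
  preserves m f -> preserves m g -> preserves m (f \o g).
Proof.
move=> [mf pf] [mg pg]; split; first exact: measurableT_comp.
move=> A mA; rewrite comp_preimage pg ?pf//.
by rewrite -[X in measurable X]setTI; exact: mf.
Qed.

Section product.
Context d1 d2 (T1 : measurableType d1) (T2 : measurableType d2).
Variable m1 : {sigma_finite_measure set T1 -> \bar R}.
Variable m2 : {sigma_finite_measure set T2 -> \bar R}.

(** Fubini: the slice of the preimage at [x] is the preimage of the slice under [h x]. *)
Lemma preserves_shear_snd (h : T1 -> T2 -> T2) :
  measurable_fun setT (fun z : T1 * T2 => h z.1 z.2) ->
  (forall x, preserves m2 (h x)) ->
  preserves (m1 \x m2)%E (fun z : T1 * T2 => (z.1, h z.1 z.2)).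
Proof.
move=> mh ph; split.
  by apply/measurable_fun_pairP; split => //; exact: measurable_fst.
move=> A mA; apply: eq_integral => x _ /=.
rewrite -[RHS](proj2 (ph x)); last exact: measurable_xsection.
by congr (m2 _); apply/seteqP; split => y; rewrite /= !xsectionP/= ?inE.
Qed.

(** The product measure integrates slices over the first factor; Tonelli supplies the other order,
    which shears moving the first coordinate require. *)
Lemma product_measure_ysection (A : set (T1 * T2)) : measurable A ->
  (m1 \x m2)%E A = (\int[m2]_y m1 (ysection A y))%E.
Proof.
move=> mA; transitivity (\int[m1]_x (fubini_F m2 (EFin \o \1_A)) x)%E.
  by rewrite indic_fubini_tonelli_FE.
by rewrite indic_fubini_tonelli// indic_fubini_tonelli_GE.
Qed.

Lemma preserves_shear_fst (g : T2 -> T1 -> T1) :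
  measurable_fun setT (fun z : T1 * T2 => g z.2 z.1) ->
  (forall y, preserves m1 (g y)) ->
  preserves (m1 \x m2)%E (fun z : T1 * T2 => (g z.2 z.1, z.2)).
Proof.
move=> mg pg.
have mf : measurable_fun setT (fun z : T1 * T2 => (g z.2 z.1, z.2)).
  by apply/measurable_fun_pairP; split => //; exact: measurable_snd.
split=> // A mA.
rewrite !product_measure_ysection//; last first.
  by rewrite -[X in measurable X]setTI; exact: mf.
apply: eq_integral => y _ /=.
rewrite -[RHS](proj2 (pg y)); last exact: measurable_ysection.
by congr (m1 _); apply/seteqP; split => x; rewrite /= !ysectionP/= ?inE.
Qed.

Lemma product_measure_sigma_finite : sigma_finite setT (m1 \x m2)%E.
Proof.
have [F TF F_fin] := sigma_finiteT m1.
have [G TG G_fin] := sigma_finiteT m2.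
pose d n := odflt (0%N, 0%N) (unpickle n : option (nat * nat)).
exists (fun n => F (d n).1 `*` G (d n).2).
  apply/seteqP; split => // -[x y] _.
  have [i _ Fx] : (\bigcup_i F i) x by rewrite -TF.
  have [j _ Gy] : (\bigcup_j G j) y by rewrite -TG.
  by exists (pickle (i, j)) => //; rewrite /d pickleK.
move=> n; have [mF Foo] := F_fin (d n).1; have [mG Goo] := G_fin (d n).2.
split; first exact: measurableX.
by rewrite product_measure1E// lte_mul_pinfty// ge0_fin_numE.
Qed.

(** The sigma-finite packaging lets products be nested up to dimension four. *)
Definition product_sigma_finite_measure :
    {sigma_finite_measure set (T1 * T2)%type -> \bar R} :=
  HB.pack_for (SigmaFiniteMeasure.type (T1 * T2)%type R) (m1 \x m2)%E
    (Measure_isSigmaFinite.Build _ _ _ (m1 \x m2)%E product_measure_sigma_finite).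

End product.

Local Notation mu := (@lebesgue_measure R).
Local Notation RR := (measurableTypeR R).

Lemma preserves_translation (a : R) : preserves mu (fun x : RR => x + a : RR).
Proof.
have mf : measurable_fun setT (fun x : RR => x + a : RR).
  by apply: measurable_funD.
split=> // A mA.
change (pushforward mu (fun x : RR => x + a : RR) A = mu A).
apply/esym; apply: lebesgue_measure_unique => //= _ [[b c]] _ <-.
rewrite /pushforward.
rewrite (_ : _ @^-1` _ = `]b - a, c - a]%classic); last first.
  by apply/seteqP; split => x; rewrite /= !in_itv/= ltrBlDr lerBrDr.
rewrite !lebesgue_measure_itv/= !lte_fin ltrD2r.
by case: ifP => // _; rewrite -!EFinB; congr EFin; ring.
Qed.

Lemma preserves_opp : preserves mu (fun x : RR => - x : RR).
Proof.
split; first exact: oppr_measurable.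
by move=> A mA; exact: lebesgue_measureN.
Qed.

End preserves_lemmas.

(** * Reflections of the four-dimensional space *)

Section reflections.
Context (R : realType).

Local Notation mu := (@lebesgue_measure R).
Local Notation RR := (measurableTypeR R).
Local Notation E2 := (RR * RR)%type.
Local Notation E3 := (RR * (RR * RR))%type.
Local Notation E4 := (RR * (RR * (RR * RR)))%type.

Definition leb2 := product_sigma_finite_measure mu mu.
Definition leb3 := product_sigma_finite_measure mu leb2.
Definition leb4 := product_sigma_finite_measure mu leb3.

Implicit Types (n p q : E4).

Definition pdot n p : R :=
  n.1 * p.1 + n.2.1 * p.2.1 + n.2.2.1 * p.2.2.1 + n.2.2.2 * p.2.2.2.

Definition reflect n p : E4 :=
  (p.1 - 2 * pdot n p * n.1, (p.2.1 - 2 * pdot n p * n.2.1,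
   (p.2.2.1 - 2 * pdot n p * n.2.2.1, p.2.2.2 - 2 * pdot n p * n.2.2.2))).

Lemma pdotC n p : pdot n p = pdot p n.
Proof. by rewrite /pdot; ring. Qed.

Lemma pdot_reflect n p q :
  pdot q (reflect n p) = pdot q p - 2 * pdot n p * pdot q n.
Proof. by rewrite /reflect /pdot /=; ring. Qed.

Lemma measurable_coord0 : measurable_fun setT (fun p : E4 => p.1 : RR).
Proof. exact: measurable_fst. Qed.

Lemma measurable_coord1 : measurable_fun setT (fun p : E4 => p.2.1 : RR).
Proof. exact: (measurableT_comp measurable_fst measurable_snd). Qed.

Lemma measurable_coord2 : measurable_fun setT (fun p : E4 => p.2.2.1 : RR).
Proof.
apply: (measurableT_comp measurable_fst).
exact: (measurableT_comp measurable_snd measurable_snd).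
Qed.

Lemma measurable_coord3 : measurable_fun setT (fun p : E4 => p.2.2.2 : RR).
Proof.
apply: (measurableT_comp measurable_snd).
exact: (measurableT_comp measurable_snd measurable_snd).
Qed.

Ltac measR := repeat first
  [ apply: measurable_funD | apply: measurable_funM | apply: measurable_funN
  | exact: measurable_cst
  | exact: measurable_coord0 | exact: measurable_coord1
  | exact: measurable_coord2 | exact: measurable_coord3 ].

Lemma measurable_pdot n : measurable_fun setT (fun p : E4 => pdot n p : RR).
Proof. by rewrite /pdot; measR. Qed.

Lemma preserves_translation3 (b : E3) :
  preserves leb3 (fun y : E3 => (y.1 + b.1, (y.2.1 + b.2.1, y.2.2 + b.2.2)) : E3).
Proof.
have tr2 (c : E2) : preserves leb2 (fun z : E2 => (z.1 + c.1, z.2 + c.2) : E2).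
  apply: (@preserves_comp _ _ _ leb2 (fun z : E2 => (z.1 + c.1, z.2))
            (fun z : E2 => (z.1, z.2 + c.2))).
  - apply: (@preserves_shear_fst _ _ _ RR RR mu mu (fun=> +%R^~ c.1)) => [|y].
      by apply: measurable_funD => //; exact: measurable_fst.
    exact: preserves_translation.
  - apply: (@preserves_shear_snd _ _ _ RR RR mu mu (fun=> +%R^~ c.2)) => [|y].
      by apply: measurable_funD => //; exact: measurable_snd.
    exact: preserves_translation.
apply: (@preserves_comp _ _ _ leb3 (fun z : E3 => (z.1 + b.1, z.2))
            (fun z : E3 => (z.1, (z.2.1 + b.2.1, z.2.2 + b.2.2)))).
- apply: (@preserves_shear_fst _ _ _ RR E2 mu leb2 (fun=> +%R^~ b.1)) => [|y].
    by apply: measurable_funD => //; exact: measurable_fst.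
  exact: preserves_translation.
- apply: (@preserves_shear_snd _ _ _ RR E2 mu leb2
    (fun=> fun z => (z.1 + b.2.1, z.2 + b.2.2))) => [|y].
    apply/measurable_fun_pairP; split; apply: measurable_funD => //.
      exact: (measurableT_comp measurable_fst measurable_snd).
    exact: (measurableT_comp measurable_snd measurable_snd).
  exact: tr2.
Qed.

(* In the coordinates [t = pdot n p / n.1, p.2], obtained from [p] by a shear,
   the reflection is the flip of [t] followed by a shear along [t]. *)
Lemma preserves_reflect_nz n : pdot n n = 1 -> n.1 != 0 ->
  preserves leb4 (reflect n).
Proof.
move=> n1 n0.
pose c (y : E3) : R := (n.2.1 * y.1 + n.2.2.1 * y.2.1 + n.2.2.2 * y.2.2) / n.1.
have mc : measurable_fun setT (fun p : E4 => c p.2 : RR).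
  by rewrite /c; measR.
have psh (s : R) : preserves leb4 (fun p : E4 => (p.1 + s * c p.2, p.2)).
  apply: (@preserves_shear_fst _ _ _ RR E3 mu leb3 (fun y x => x + s * c y)).
    by apply: measurable_funD; [exact: measurable_coord0|exact: measurable_funM].
  by move=> y; exact: preserves_translation.
have pflip : preserves leb4 (fun p : E4 => (- p.1, p.2)).
  apply: (@preserves_shear_fst _ _ _ RR E3 mu leb3 (fun=> -%R)).
    by apply: measurable_funN; exact: measurable_coord0.
  by move=> y; exact: preserves_opp.
(* At [t = pdot n p / n.1], the product [k * t] is [2 * pdot n p], the factor in [reflect]. *)
pose k := 2 * n.1.
have psnd : preserves leb4 (fun p : E4 => (p.1, (p.2.1 - k * p.1 * n.2.1,
    (p.2.2.1 - k * p.1 * n.2.2.1, p.2.2.2 - k * p.1 * n.2.2.2)))).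
  apply: (@preserves_shear_snd _ _ _ RR E3 mu leb3
    (fun x y => (y.1 - k * x * n.2.1,
       (y.2.1 - k * x * n.2.2.1, y.2.2 - k * x * n.2.2.2)))).
    by repeat (apply/measurable_fun_pairP; split); rewrite /=; measR.
  move=> x; exact: (preserves_translation3
    (- (k * x * n.2.1), (- (k * x * n.2.2.1), - (k * x * n.2.2.2)))).
have := preserves_comp (psh (-1)) (preserves_comp pflip (preserves_comp psnd (psh 1))).
congr preserves; apply/funext => -[x [y [z w]]].
move: n1 n0; rewrite /reflect /pdot /c /k /=.
case: n {c mc psh k psnd} => a [b [d e]] /= n1 n0.
congr (_, (_, (_, _))); try by field.
apply: subr0_eq.
transitivity ((a * a + b * b + d * d + e * e - 1) *
              (2 * (x + (b * y + d * z + e * w) / a))); first by field.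
by rewrite n1 subrr mul0r.
Qed.

(** When [n.1 = 0], conjugate: [m] is the unit vector along [e0 + n], its reflection exchanges [e0]
    and [- n], so [reflect n] is [reflect m], then [reflect e0], then [reflect m]. Both [m] and [e0]
    have a nonzero first coordinate. *)
Lemma preserves_reflect n : pdot n n = 1 -> preserves leb4 (reflect n).
Proof.
move=> n1; have [n0|] := eqVneq n.1 0; last exact: preserves_reflect_nz.
pose s : R := (Num.sqrt 2)^-1.
have s2 : s * s = 2^-1 by rewrite -invfM -expr2 sqr_sqrtr.
pose e0 : E4 := (1, (0, (0, 0))).
pose m : E4 := (s, (s * n.2.1, (s * n.2.2.1, s * n.2.2.2))).
have m1 : pdot m m = 1.
  transitivity (s * s * (1 + pdot n n)); last by rewrite n1 s2; field.
  by rewrite /pdot /m /= n0; ring.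
have pm : preserves leb4 (reflect m).
  by apply: preserves_reflect_nz; rewrite //= invr_eq0 sqrtr_eq0 -ltNge.
have pe : preserves leb4 (reflect e0).
  by apply: preserves_reflect_nz; rewrite /pdot /e0 /= ?oner_eq0//; ring.
have := preserves_comp pm (preserves_comp pe pm).
have rm p : reflect m p = let t := p.1 + (n.2.1 * p.2.1 +
    n.2.2.1 * p.2.2.1 + n.2.2.2 * p.2.2.2) in
    (p.1 - t, (p.2.1 - t * n.2.1,
       (p.2.2.1 - t * n.2.2.1, p.2.2.2 - t * n.2.2.2))) :> E4.
  have s2' k t : 2 * (s * t) * (s * k) = t * k.
    by transitivity (2 * (s * s) * (t * k)); [ring | rewrite s2; field].
  have d : pdot m p = s * (p.1 + (n.2.1 * p.2.1 +
    n.2.2.1 * p.2.2.1 + n.2.2.2 * p.2.2.2)) by rewrite /pdot /m /=; ring.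
  by rewrite /reflect d /m /= !s2' -{2}[s]mulr1 s2' mulr1.
congr preserves; apply/funext => p; rewrite /= !rm.
move: n1 n0; rewrite /reflect /pdot /e0 /=.
case: n p {m m1 pm e0 pe rm} => a [b [d e]] [x [y [z w]]] /= n1 n0.
rewrite n0 in n1 *.
have S k : (0 * 0 + b * b + d * d + e * e - 1) *
    (x + (b * y + d * z + e * w)) * k = 0 by rewrite n1 subrr !mul0r.
congr (_, (_, (_, _))); apply: subr0_eq.
- by apply: etrans (S 1); ring.
- by apply: etrans (S b); ring.
- by apply: etrans (S d); ring.
- by apply: etrans (S e); ring.
Qed.
End reflections.

(** * Volume of the unit ball *)

Section ball_volume.
Context (R : realType).

Local Notation mu := (@lebesgue_measure R).
Local Notation RR := (measurableTypeR R).

Lemma derivable_LRcontinuous (F : R -> R) (a b : R) :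
  (forall x : R, derivable F x 1) -> derivable_oo_LRcontinuous F a b.
Proof.
move=> dF; have cF x : F y @[y --> x] --> F x.
  exact/differentiable_continuous/derivable1_diffP.
by split=> [x _//||]; [exact: cvg_at_right_filter|exact: cvg_at_left_filter].
Qed.

Lemma FTC2_is_derive (f F : R -> R) (a b : R) : a < b ->
  continuous f -> (forall x : R, is_derive x 1 F (f x)) ->
  (\int[mu]_(x in `[a, b]) (f x)%:E = (F b - F a)%:E)%E.
Proof.
move=> ab cf dF; rewrite EFinB; apply: continuous_FTC2 => //.
- exact: continuous_subspaceT.
- by apply: derivable_LRcontinuous => x; exact: ex_derive.
- by move=> x _; rewrite derive1E derive_val.
Qed.

Lemma powr_sqrt_continuous (c s : R) k :
  continuous (fun y : R => c * Num.sqrt (s - y ^+ 2) ^+ k).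
Proof.
move=> y; apply: cvgM; first exact: cvg_cst.
apply: (@continuous_comp _ _ _ (fun y : R => Num.sqrt (s - y ^+ 2))
  (fun z : R => z ^+ k)); last exact: exprn_continuous.
apply: continuous_comp; last exact: sqrt_continuous.
by apply: cvgB; [exact: cvg_cst|exact: exprn_continuous].
Qed.

(** The induction step for volumes of balls: a slice at height [y] is a ball of squared radius
    [s - y ^+ 2], and [y = r * sin t] turns the integral of the slices into one of a power of the
    cosine. *)
Lemma integral_sqrt_pow (c s : R) (k : nat) (J : R -> R) : 0 <= c ->
  (forall t : R, is_derive t 1 J (cos t ^+ k.+2)) ->
  (\int[mu]_(y in [set: RR]) (c * Num.sqrt (s - y ^+ 2) ^+ k.+1)%:E =
   (c * Num.sqrt s ^+ k.+2 * (J (pi / 2) - J (- (pi / 2))))%:E)%E.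
Proof.
move=> c0 dJ.
have [s0|s0] := leP s 0.
  rewrite (ler0_sqrtr s0) expr0n/= mulr0 mul0r.
  apply: integral0_eq => y _.
  by rewrite ler0_sqrtr ?expr0n ?mulr0// subr_le0 (le_trans s0)// sqr_ge0.
set r := Num.sqrt s; have r0 : 0 < r by rewrite sqrtr_gt0.
have rs : r ^+ 2 = s by rewrite sqr_sqrtr// ltW.
have pi0 : 0 < pi / 2 :> R by rewrite divr_gt0// pi_gt0.
have pi2 : - (pi / 2) < pi / 2 :> R by rewrite gtrN.
pose F t := r * sin t.
have dF (t : R) : is_derive t 1 F (r * cos t).
  by apply: is_derive_eq.
have F'E : F^`()%classic = (fun t => r * cos t).
  by apply/funext => t; rewrite derive1E derive_val.
have cF' : continuous (fun t => r * cos t).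
  by move=> x; apply: cvgM; [exact: cvg_cst|exact: continuous_cos].
have Fr : F (pi / 2) = r by rewrite /F sin_pihalf mulr1.
have FNr : F (- (pi / 2)) = - r by rewrite /F sinN sin_pihalf mulrN1.
(* Outside [[- r, r]] the radicand is negative and [Num.sqrt] returns 0, so integrating over the
   whole line changes nothing. *)
transitivity (\int[mu]_(y in `[F (- (pi / 2))%R, F (pi / 2)%R])
    (c * Num.sqrt (s - y ^+ 2) ^+ k.+1)%:E)%E.
  rewrite [RHS]integral_mkcond; apply: eq_integral => y _.
  rewrite patchE mem_setE in_itv/= Fr FNr -ler_norml.
  have [//|yr] := leP `|y| r.
  rewrite ler0_sqrtr ?expr0n ?mulr0// subr_le0 -rs -[leRHS]real_normK ?num_real//.
  by rewrite lerXn2r ?nnegrE// ltW.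
rewrite (integration_by_substitution_increasing (ltW pi2)).
- rewrite F'E (_ : (c * r ^+ k.+2 * _)%:E = \int[mu]_(x in `[(- (pi / 2))%R, (pi / 2)%R])
     (c * r ^+ k.+2 * cos x ^+ k.+2)%:E)%E.
    apply: eq_integral => t; rewrite inE/= in_itv/= => /andP[t1 t2]; congr EFin.
    rewrite -[LHS]/(c * Num.sqrt (s - F t ^+ 2) ^+ k.+1 * (r * cos t)).
    have -> : s - F t ^+ 2 = (r * cos t) ^+ 2.
      by rewrite /F !exprMn cos2sin2 rs; ring.
    rewrite sqrtr_sqr ger0_norm ?exprMn.
      by rewrite [r ^+ k.+2]exprS [cos t ^+ k.+2]exprS; ring.
    by rewrite mulr_ge0 ?(ltW r0)// cos_ge0_pihalf// t1.
  rewrite (@FTC2_is_derive _ (fun t => c * r ^+ k.+2 * J t))//.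
  + by congr EFin; ring.
  + move=> x; apply: cvgM; first exact: cvg_cst.
    apply: (@continuous_comp _ _ _ cos (fun z : R => z ^+ k.+2)).
      exact: continuous_cos.
    exact: exprn_continuous.
- move=> x y; rewrite !in_itv/= => xI yI xy.
  by rewrite /F ltr_pM2l// ltr_sin// in_itv.
- by rewrite F'E => x _; exact: cF'.
- by rewrite F'E; apply: cvgP; apply: cvg_at_right_filter; exact: cF'.
- by rewrite F'E; apply: cvgP; apply: cvg_at_left_filter; exact: cF'.
- by apply: derivable_LRcontinuous => x; exact: ex_derive.
- by apply: continuous_subspaceT; exact: powr_sqrt_continuous.
Qed.

(** Using the squared radius [s] as parameter keeps the formula uniform: for negative [s] the set is
    empty and [Num.sqrt s] is 0. *)
Lemma lebesgue_measure_sqr_le (s : R) :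
  mu [set z : RR | z ^+ 2 <= s] = (2 * Num.sqrt s)%:E.
Proof.
have [s0|s0] := leP 0 s.
  rewrite (_ : [set _ | _] = `[- Num.sqrt s, Num.sqrt s]%classic).
    rewrite lebesgue_measure_itv/= lte_fin.
    have : 0 <= Num.sqrt s by exact: sqrtr_ge0.
    rewrite le_eqVlt => /predU1P[<-|r0]; first by rewrite oppr0 ltxx mulr0.
    by rewrite gtrN// opprK -EFinD; congr EFin; ring.
  have zs (z : R) : (z ^+ 2 <= s) = (`|z| <= Num.sqrt s).
    rewrite -[RHS](@ler_pXn2r _ 2%N)// ?nnegrE ?sqrtr_ge0//.
    by rewrite real_normK ?num_real// sqr_sqrtr.
  by apply/seteqP; split => z; rewrite /= in_itv/= -ler_norml zs.
rewrite (_ : [set _ | _] = set0); last first.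
  apply/seteqP; split => z //=; apply/negP; rewrite -ltNge.
  by rewrite (lt_le_trans s0)// sqr_ge0.
by rewrite measure0 ltr0_sqrtr// mulr0.
Qed.

End ball_volume.

Section ball_volume4.
Context (R : realType).

Local Notation mu := (@lebesgue_measure R).
Local Notation RR := (measurableTypeR R).
Local Notation E2 := (RR * RR)%type.
Local Notation E3 := (RR * (RR * RR))%type.
Local Notation E4 := (RR * (RR * (RR * RR)))%type.

Lemma is_derive_cos2_primitive (t : R) :
  is_derive t 1 (fun t : R => 2^-1 * (t + sin t * cos t)) (cos t ^+ 2).
Proof.
apply: is_derive_eq; rewrite -[LHS]/(2^-1 * (1 + (sin t * - sin t + cos t * cos t))).
by rewrite mulrN -expr2 -expr2 sin2cos2; field.
Qed.

Lemma is_derive_cos3_primitive (t : R) :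
  is_derive t 1 (fun t : R => sin t - 3^-1 * (sin t * (sin t * sin t))) (cos t ^+ 3).
Proof.
apply: is_derive_eq.
rewrite -[LHS]/(cos t - 3^-1 * (sin t * (sin t * cos t + sin t * cos t) +
  sin t * sin t * cos t)).
by rewrite [RHS]exprSr cos2sin2; field.
Qed.

Lemma is_derive_cos4_primitive (t : R) :
  is_derive t 1 (fun t : R => 8^-1 * (3 * t + sin t * (cos t *
    (3 + 2 * (cos t * cos t))))) (cos t ^+ 4).
Proof.
apply: is_derive_eq.
rewrite -[LHS]/(8^-1 * (3 * 1 + (sin t * (cos t * ((0 + 1) * (2 * (cos t * - sin t +
   cos t * - sin t))) + (3 + 2 * (cos t * cos t)) * - sin t) +
   cos t * (3 + 2 * (cos t * cos t)) * cos t))).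
have s2 := sin2cos2 t.
transitivity (8^-1 * (3 - sin t ^+ 2 * (3 + 6 * cos t ^+ 2) +
   3 * cos t ^+ 2 + 2 * cos t ^+ 4)); first by ring.
by rewrite s2; field.
Qed.

Lemma leb2_disc (s : R) :
  leb2 R [set z : E2 | z.1 ^+ 2 + z.2 ^+ 2 <= s] = (pi * Num.sqrt s ^+ 2)%:E.
Proof.
transitivity (\int[mu]_(y in [set: RR]) (2 * Num.sqrt (s - y ^+ 2) ^+ 1)%:E)%E.
  apply: eq_integral => y _ /=; rewrite expr1 -lebesgue_measure_sqr_le.
  by congr (mu _); apply/seteqP; split => z; rewrite /= xsectionP/= ?inE/= lerBrDl.
rewrite (integral_sqrt_pow _ _ is_derive_cos2_primitive)//.
by congr EFin; rewrite sinN cosN sin_pihalf cos_pihalf; field.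
Qed.

Lemma leb3_ball (s : R) :
  leb3 R [set z : E3 | z.1 ^+ 2 + (z.2.1 ^+ 2 + z.2.2 ^+ 2) <= s] =
  (4 / 3 * pi * Num.sqrt s ^+ 3)%:E.
Proof.
transitivity (\int[mu]_(y in [set: RR]) (pi * Num.sqrt (s - y ^+ 2) ^+ 2)%:E)%E.
  apply: eq_integral => y _ /=; rewrite -leb2_disc.
  by congr (leb2 R _); apply/seteqP; split => z; rewrite /= xsectionP/= ?inE/= lerBrDl.
rewrite (integral_sqrt_pow _ _ is_derive_cos3_primitive) ?pi_ge0//.
by congr EFin; rewrite sinN sin_pihalf; field.
Qed.

Definition ball4 := [set p : E4 | pdot p p <= 1].

Lemma leb4_ball4 : leb4 R ball4 = (pi ^+ 2 / 2)%:E.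
Proof.
transitivity (\int[mu]_(y in [set: RR])
    (4 / 3 * pi * Num.sqrt (1 - y ^+ 2) ^+ 3)%:E)%E.
  apply: eq_integral => y _ /=; rewrite -leb3_ball.
  by congr (leb3 R _); apply/seteqP; split => z; rewrite /= xsectionP/= ?inE/=
    /ball4/= /pdot/= -!expr2 lerBrDl !addrA.
rewrite (integral_sqrt_pow _ _ is_derive_cos4_primitive); last first.
  by rewrite !mulr_ge0 ?pi_ge0.
by congr EFin; rewrite sinN cosN sin_pihalf cos_pihalf sqrtr1; field.
Qed.

End ball_volume4.

(** * Volumes of spherical wedges and triangles *)

(** On cones this is a quarter of the spherical volume of the trace on the sphere; being
    real-valued, it allows subtraction. *)
HB.lock Definition vol {R : realType} (A : set (R * (R * (R * R)))) : R :=
  fine (leb4 R (A `&` @ball4 R)).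
Canonical locked_vol := Unlockable vol.unlock.

Section spherical_volume.
Context (R : realType).

Local Notation RR := (measurableTypeR R).
Local Notation E4 := (RR * (RR * (RR * RR)))%type.
Local Notation leb4 := (leb4 R).

Implicit Types (n p q : E4) (A : set E4).

Lemma measurable_pdot_ge0 n : measurable [set p : E4 | 0 <= pdot n p].
Proof.
rewrite -[X in measurable X]setTI.
have := @measurable_pdot R n measurableT _ (measurable_itv `[0, +oo[).
by congr measurable; apply/seteqP; split => p;
  rewrite /= in_itv/= andbT.
Qed.

Lemma measurable_pdot_le0 n : measurable [set p : E4 | pdot n p <= 0].
Proof.
rewrite -[X in measurable X]setTI.
have := @measurable_pdot R n measurableT _ (measurable_itv `]-oo, 0]).
by congr measurable; apply/seteqP; split => p; rewrite /= in_itv.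
Qed.

Lemma measurable_pdot_eq0 n : measurable [set p : E4 | pdot n p = 0].
Proof.
rewrite (_ : [set _ | _] = [set p | 0 <= pdot n p] `&` [set p | pdot n p <= 0]).
  by apply: measurableI; [exact: measurable_pdot_ge0|exact: measurable_pdot_le0].
apply/seteqP; split => p /=; first by move=> ->.
by case=> h1 h2; apply/eqP; rewrite eq_le h1 h2.
Qed.

Lemma measurable_ball4 : measurable (@ball4 R).
Proof.
have m : measurable_fun setT (fun p : E4 => pdot p p : RR).
  by rewrite /pdot; do ![exact: measurable_coord0|exact: measurable_coord1|
    exact: measurable_coord2|exact: measurable_coord3|apply: measurable_funD|
    apply: measurable_funM].
rewrite -[X in measurable X]setTI.
have := m measurableT _ (measurable_itv `]-oo, 1]).
by congr measurable; apply/seteqP; split => p; rewrite /= in_itv.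
Qed.

Lemma leb4_ball_fin A : measurable A -> leb4 (A `&` @ball4 R) \is a fin_num.
Proof.
move=> mA; rewrite ge0_fin_numE//.
apply: (@le_lt_trans _ _ (leb4 (@ball4 R))); last by rewrite leb4_ball4 ltry.
apply: le_measure; rewrite ?inE//; [apply: measurableI => //|]; exact: measurable_ball4.
Qed.

Lemma pdot_reflect_id n p :
  pdot n n = 1 -> pdot (reflect n p) (reflect n p) = pdot p p.
Proof.
move=> n1; rewrite pdot_reflect ![pdot (reflect n p) _]pdotC !pdot_reflect n1.
by rewrite [pdot p n]pdotC; ring.
Qed.

Lemma vol_reflect n A : pdot n n = 1 -> measurable A ->
  vol (reflect n @^-1` A) = vol A.
Proof.
move=> n1 mA; rewrite unlock.
have mAB : measurable (A `&` @ball4 R).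
  by apply: measurableI => //; exact: measurable_ball4.
rewrite -(proj2 (preserves_reflect n1) _ mAB).
congr (fine (leb4 _)); apply/seteqP.
by split => p /= [Ap]; rewrite /ball4/= pdot_reflect_id.
Qed.

(** The hyperplane [p.1 = 0] is a product with a null factor, and the reflection along [m - e0],
    where [e0] is the first basis vector, carries it to the hyperplane orthogonal to [m]. This
    vector vanishes when [m.1 = 1]; then [- n], which defines the same hyperplane, is used
    instead. *)
Lemma leb4_hyperplane n : pdot n n = 1 -> leb4 [set p | pdot n p = 0] = 0%E.
Proof.
have e0 : leb4 [set p : E4 | p.1 = 0] = 0%E.
  rewrite (_ : [set _ | _] = [set 0] `*` setT); last first.
    by apply/seteqP; split => p //= [].
  apply: etrans (product_measure1E (@lebesgue_measure R) (leb3 R) _ _) _ => //=.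
  by rewrite lebesgue_measure_set1 mul0e.
have H m : pdot m m = 1 -> m.1 != 1 -> leb4 [set p | pdot m p = 0] = 0%E.
  move=> m1 m01.
  pose u : E4 := (m.1 - 1, m.2).
  have uu : pdot u u = 2 * (1 - m.1).
    transitivity (pdot m m + 1 - 2 * m.1); first by rewrite /pdot /u/=; ring.
    by rewrite m1; ring.
  have uu0 : 0 < pdot u u.
    have un0 : pdot u u != 0 by rewrite uu mulf_neq0// subr_eq0 eq_sym.
    by rewrite lt_neqAle eq_sym un0 /pdot -!expr2 !addr_ge0 ?sqr_ge0.
  pose s : R := (Num.sqrt (pdot u u))^-1.
  have s2 : s * s = (pdot u u)^-1 by rewrite -invfM -expr2 sqr_sqrtr// ltW.
  pose v : E4 := (s * u.1, (s * u.2.1, (s * u.2.2.1, s * u.2.2.2))).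
  have v1 : pdot v v = 1.
    transitivity (s * s * pdot u u); first by rewrite /pdot /v/=; ring.
    by rewrite s2 mulVf// gt_eqF.
  rewrite -(proj2 (preserves_reflect v1) _ (measurable_pdot_eq0 m)).
  rewrite -[RHS]e0; congr (leb4 _); apply/seteqP.
  suff mE p : pdot m (reflect v p) = p.1 by split => p /=; rewrite mE.
  rewrite pdot_reflect.
  transitivity (pdot m p - 2 * (s * s) * pdot u p * pdot m u).
    by congr (_ - _); rewrite /pdot /v /=; ring.
  have -> : pdot m u = pdot m m - m.1 by rewrite /pdot/=; ring.
  rewrite s2 uu m1; transitivity (pdot m p - pdot u p).
    by congr (_ - _); field; rewrite subr_eq0 eq_sym.
  by rewrite /pdot/=; ring.
move=> n1; have [n01|] := eqVneq n.1 1; last exact: H.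
pose k : E4 := (- n.1, (- n.2.1, (- n.2.2.1, - n.2.2.2))).
have kE p : pdot k p = - pdot n p by rewrite /pdot/=; ring.
rewrite -[RHS](H k).
- congr (leb4 _); apply/seteqP; split => p /=; rewrite kE; first by move=> ->; rewrite oppr0.
  by move/eqP; rewrite oppr_eq0 => /eqP.
- by rewrite kE pdotC kE opprK.
- by rewrite /= n01 -subr_eq0 -opprD oppr_eq0 -[1 + 1]/(2%:R) pnatr_eq0.
Qed.

Lemma vol_split n A : pdot n n = 1 -> measurable A ->
  vol A = vol (A `&` [set p | 0 <= pdot n p]) +
          vol (A `&` [set p | pdot n p <= 0]).
Proof.
move=> n1 mA; set P := [set p | _]; set N := [set p | _].
have mP : measurable P by exact: measurable_pdot_ge0.
have mN : measurable N by exact: measurable_pdot_le0.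
have mAB : measurable (A `&` @ball4 R).
  by apply: measurableI => //; exact: measurable_ball4.
have mAP : measurable (A `&` P) by exact: measurableI.
have mAN : measurable (A `&` N) by exact: measurableI.
rewrite unlock -fineD; [|exact: leb4_ball_fin..].
have mZ : measurable (A `&` @ball4 R `&` [set p | pdot n p = 0]).
  by apply: measurableI => //; exact: measurable_pdot_eq0.
have mD : measurable (A `&` @ball4 R `\` P) by exact: measurableD.
have -> : leb4 (A `&` P `&` @ball4 R) = leb4 (A `&` @ball4 R `&` P).
  by rewrite setIAC.
have -> : leb4 (A `&` N `&` @ball4 R) = leb4 (A `&` @ball4 R `\` P).
  have Z0 : leb4 (A `&` @ball4 R `&` [set p | pdot n p = 0]) = 0%E.
    apply: (@subset_measure0 _ _ _ leb4 _ [set p | pdot n p = 0]) => //.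
      exact: measurable_pdot_eq0.
    exact: leb4_hyperplane.
  rewrite -(measureU0 mD mZ Z0); congr (leb4 _); apply/seteqP; split => p /=.
    rewrite /N/= le_eqVlt => -[[Ap] /predU1P[p0|p0] Bp]; [by right|left].
    by split => // ; apply/negP; rewrite -ltNge.
  case=> [[[Ap Bp]] /negP|[[Ap Bp] p0]]; last by rewrite /N/= p0.
  by rewrite /P/= -ltNge => /ltW.
by congr fine; rewrite addeC; exact: measureDI.
Qed.

End spherical_volume.

(** * Wedges and Girard's formula *)

Section girard.
Context (R : realType).

Local Notation RR := (measurableTypeR R).
Local Notation E4 := (RR * (RR * (RR * RR)))%type.

Implicit Types (n p q : E4) (A : set E4).

Definition lincomb (a : R) n (b : R) p : E4 :=
  (a * n.1 + b * p.1, (a * n.2.1 + b * p.2.1,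
    (a * n.2.2.1 + b * p.2.2.1, a * n.2.2.2 + b * p.2.2.2))).

Lemma pdot_lincomb a n b p q :
  pdot (lincomb a n b p) q = a * pdot n q + b * pdot p q.
Proof. by rewrite /pdot/=; ring. Qed.

Lemma measurable_reflect n A :
  pdot n n = 1 -> measurable A -> measurable (reflect n @^-1` A).
Proof.
by move=> n1 mA; rewrite -[X in measurable X]setTI; apply: (proj1 (preserves_reflect n1)).
Qed.

(** The antipodal map is the product of the four coordinate reflections. *)
Lemma vol_opp A : measurable A ->
  vol [set p : E4 | A (- p.1, (- p.2.1, (- p.2.2.1, - p.2.2.2)))] = vol A.
Proof.
move=> mA.
pose e0 : E4 := (1, (0, (0, 0))); pose e1 : E4 := (0, (1, (0, 0))).
pose e2 : E4 := (0, (0, (1, 0))); pose e3 : E4 := (0, (0, (0, 1))).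
have u0 : pdot e0 e0 = 1 by rewrite /pdot/=; ring.
have u1 : pdot e1 e1 = 1 by rewrite /pdot/=; ring.
have u2 : pdot e2 e2 = 1 by rewrite /pdot/=; ring.
have u3 : pdot e3 e3 = 1 by rewrite /pdot/=; ring.
have m0 := measurable_reflect u0 mA; have m1 := measurable_reflect u1 m0.
have m2 := measurable_reflect u2 m1.
rewrite -(vol_reflect u0 mA) -(vol_reflect u1 m0) -(vol_reflect u2 m1) -(vol_reflect u3 m2).
congr vol; apply/seteqP.
suff E p : (- p.1, (- p.2.1, (- p.2.2.1, - p.2.2.2))) =
    reflect e0 (reflect e1 (reflect e2 (reflect e3 p))) by split => p /=; rewrite E.
have r0 q : reflect e0 q = (- q.1, (q.2.1, (q.2.2.1, q.2.2.2))).
  by congr (_, (_, (_, _))); rewrite /pdot/=; ring.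
have r1 q : reflect e1 q = (q.1, (- q.2.1, (q.2.2.1, q.2.2.2))).
  by congr (_, (_, (_, _))); rewrite /pdot/=; ring.
have r2 q : reflect e2 q = (q.1, (q.2.1, (- q.2.2.1, q.2.2.2))).
  by congr (_, (_, (_, _))); rewrite /pdot/=; ring.
have r3 q : reflect e3 q = (q.1, (q.2.1, (q.2.2.1, - q.2.2.2))).
  by congr (_, (_, (_, _))); rewrite /pdot/=; ring.
by rewrite r3 r2 r1 r0.
Qed.

Lemma volT : vol [set: E4] = pi ^+ 2 / 2.
Proof. by rewrite unlock setTI leb4_ball4. Qed.

Lemma vol_halfspace n : pdot n n = 1 ->
  vol [set p | 0 <= pdot n p] = vol [set: E4] / 2.
Proof.
move=> n1; rewrite (vol_split n1 measurableT) !setTI.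
rewrite -(vol_reflect n1 (measurable_pdot_le0 n)).
rewrite (_ : _ @^-1` _ = [set p | 0 <= pdot n p]); first by field.
by apply/seteqP; split => p; rewrite /= pdot_reflect n1; lra.
Qed.

Section wedge.
Variables (n m : E4).
Hypotheses (n1 : pdot n n = 1) (m1 : pdot m m = 1) (nm : pdot n m = 0).

Let N (t : R) := lincomb (cos t) n (sin t) m.

Let NE t p : pdot (N t) p = cos t * pdot n p + sin t * pdot m p.
Proof. exact: pdot_lincomb. Qed.

Let NN s t : pdot (N s) (N t) = cos (s - t).
Proof.
rewrite NE ![pdot _ (N t)]pdotC !NE n1 m1 nm pdotC nm cosB; ring.
Qed.

Let N1 t : pdot (N t) (N t) = 1.
Proof. by rewrite NN subrr cos0. Qed.

(** For [s <= t <= s + pi], a wedge of angle [t - s], bounded by two positions of the rotating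
    normal [N]. *)
Let W (s t : R) := [set p | 0 <= pdot (N s) p] `&` [set p | pdot (N t) p <= 0].

Let mW s t : measurable (W s t).
Proof.
by apply: measurableI; [exact: measurable_pdot_ge0|exact: measurable_pdot_le0].
Qed.

(** The reflection in the common wall [N s] exchanges the two wedges. *)
Let vol_wedge_next (s d : R) : vol (W (s - d) s) = vol (W s (s + d)).
Proof.
rewrite -(vol_reflect (N1 s) (mW _ _)); congr vol.
have E p : pdot (N (s - d)) (reflect (N s) p) = - pdot (N (s + d)) p.
  rewrite pdot_reflect NN (_ : s - d - s = - d); last by ring.
  by rewrite cosN !NE cosB cosD sinB sinD; ring.
have E' p : pdot (N s) (reflect (N s) p) = - pdot (N s) p.
  by rewrite pdot_reflect N1; ring.
apply/seteqP; split => p; rewrite /W/= E E' oppr_ge0 oppr_le0;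
  by move=> [h1 h2].
Qed.

(** Three normals in one plane are linearly dependent. For [a < b < c < a + pi] the three sines are
    positive, so two sign conditions decide the third. *)
Let sin_sub_mul a b c p : sin (c - a) * pdot (N b) p =
  sin (c - b) * pdot (N a) p + sin (b - a) * pdot (N c) p.
Proof. by rewrite !NE !sinB; ring. Qed.

Let vol_wedge_cat (b c : R) : 0 < b -> b < c -> c <= pi ->
  vol (W 0 c) = vol (W 0 b) + vol (W b c).
Proof.
move=> b0 bc cpi.
apply: etrans (vol_split (N1 b) (mW 0 c)) _; rewrite [LHS]addrC.
have sb : 0 < sin b by rewrite sin_gt0_pi// b0 (lt_le_trans bc).
have scb : 0 < sin (c - b).
  by rewrite sin_gt0_pi//; apply/andP; split; lra.
have sc : 0 <= sin c by rewrite sin_ge0_pi// cpi (ltW (lt_trans b0 bc)).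
have S p : sin c * pdot (N b) p = sin (c - b) * pdot (N 0) p + sin b * pdot (N c) p.
  by have := sin_sub_mul 0 b c p; rewrite !subr0.
congr (vol _ + vol _); apply/seteqP; split => p; rewrite /W/=.
- by move=> [[h1 h2] h3].
- move=> [h1 h2]; split => //; split => //.
  rewrite -(pmulr_rle0 _ sb).
  have -> : sin b * pdot (N c) p = sin c * pdot (N b) p - sin (c - b) * pdot (N 0) p.
    by rewrite S; ring.
  by rewrite subr_le0 (@le_trans _ _ 0) ?mulr_ge0_le0// mulr_ge0// ltW.
- by move=> [[h1 h2] h3].
- move=> [h1 h2]; split => //; split => //.
  rewrite -(pmulr_rge0 _ scb).
  have -> : sin (c - b) * pdot (N 0) p = sin c * pdot (N b) p - sin b * pdot (N c) p.
    by rewrite S; ring.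
  rewrite subr_ge0 (@le_trans _ _ 0) ?mulr_ge0//.
  by rewrite mulr_ge0_le0// ltW.
Qed.

Lemma vol_wedge_frame (k q : nat) : (0 < k)%N -> (k <= q)%N ->
  vol (W 0 (k%:R * (pi / q%:R))) = k%:R / (2 * q%:R) * vol [set: E4].
Proof.
move=> k0 kq; set d := pi / q%:R.
have q0 : (0 < q)%N by exact: leq_trans kq.
have q0' : 0 < q%:R :> R by rewrite ltr0n.
have d0 : 0 < d by rewrite divr_gt0// pi_gt0.
have qd : q%:R * d = pi by rewrite /d; field; rewrite gt_eqF.
have step i : vol (W (i%:R * d) (i.+1%:R * d)) = vol (W 0 d).
  elim: i => [|i IH]; first by rewrite mul0r mul1r.
  rewrite -IH (_ : i.+2%:R * d = i.+1%:R * d + d); last by rewrite -addn1 natrD; ring.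
  rewrite -vol_wedge_next; congr (vol (W _ _)).
  by rewrite -addn1 natrD; ring.
have sum i : (0 < i)%N -> (i <= q)%N -> vol (W 0 (i%:R * d)) = i%:R * vol (W 0 d).
  elim: i => // i IH _ iq; case: i IH iq => [|i] IH iq; first by rewrite !mul1r.
  have -> : vol (W 0 (i.+2%:R * d)) =
      vol (W 0 (i.+1%:R * d)) + vol (W (i.+1%:R * d) (i.+2%:R * d)).
    apply: vol_wedge_cat.
    - by rewrite mulr_gt0// ltr0n.
    - by rewrite ltr_pM2r// ltr_nat.
    - by rewrite -qd ler_pM2r// ler_nat.
  rewrite step IH//; last exact: ltnW.
  by rewrite -[in RHS]addn1 natrD; ring.
(* Since [N pi = - N 0], the [q] equal wedges fill the halfspace of [N 0]. *)
have full : q%:R * vol (W 0 d) = vol [set: E4] / 2.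
  rewrite -sum// qd -(vol_halfspace (N1 0)); congr vol.
  apply/seteqP; split => p /=; first by case.
  by move=> h; split => //; move: h; rewrite /= !NE cospi sinpi cos0 sin0; lra.
rewrite sum//; have -> : vol (W 0 d) = vol setT / 2 / q%:R.
  by rewrite -full; field; rewrite gt_eqF.
by field; rewrite gt_eqF.
Qed.

End wedge.

Lemma vol_wedge n m (k q : nat) : (0 < k)%N -> (k < q)%N ->
  pdot n n = 1 -> pdot m m = 1 -> pdot n m = - cos (k%:R * (pi / q%:R)) ->
  vol ([set p | 0 <= pdot n p] `&` [set p | 0 <= pdot m p]) =
  k%:R / (2 * q%:R) * vol [set: E4].
Proof.
move=> k0 kq n1 m1; set t := k%:R * _ => nm.
have q0 : 0 < q%:R :> R by rewrite ltr0n (leq_trans _ kq).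
have t0 : 0 < t by rewrite mulr_gt0 ?ltr0n// divr_gt0// pi_gt0.
have tpi : t < pi.
  rewrite /t mulrA ltr_pdivrMr// mulrC ltr_pM2l ?pi_gt0//.
  by rewrite ltr_nat.
have st : 0 < sin t by rewrite sin_gt0_pi// t0.
have st2 : sin t * sin t = 1 - cos t * cos t by rewrite -!expr2 sin2cos2.
(* Gram-Schmidt: [w] is chosen so that [- m] is [cos t] times [n] plus [sin t] times [w], the normal
   rotated by [t]. *)
pose w := lincomb (- cos t / sin t) n (- (sin t)^-1) m.
have nw : pdot n w = 0.
  by rewrite pdotC pdot_lincomb n1 [pdot m n]pdotC nm; field; rewrite gt_eqF.
have w1 : pdot w w = 1.
  rewrite pdot_lincomb nw [pdot m w]pdotC pdot_lincomb m1 nm.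
  transitivity ((1 - cos t * cos t) / (sin t * sin t)).
    by field; rewrite gt_eqF.
  by rewrite -st2 divff// mulf_neq0// gt_eqF.
rewrite -(vol_wedge_frame n1 w1 nw k0 (ltnW kq)) -/t; congr (vol (_ `&` _)).
  by apply/seteqP; split => p; rewrite /= pdot_lincomb cos0 sin0 mul0r addr0 mul1r.
suff E p : pdot (lincomb (cos t) n (sin t) w) p = - pdot m p.
  by apply/seteqP; split => p; rewrite /= E oppr_le0.
rewrite !pdot_lincomb; field; rewrite gt_eqF//.
Qed.

(** The walls of [n1] and [n2] cut the halfspace [P3] into four pieces. The piece in [M1], [M2],
    [P3] is antipodal to the one in [P1], [P2], [M3], so the three wedges together exceed the
    halfspace by exactly twice the wanted volume. *)
Lemma vol_girard n1 n2 n3 (k1 k2 k3 q1 q2 q3 : nat) :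
  (0 < k1 < q1)%N -> (0 < k2 < q2)%N -> (0 < k3 < q3)%N ->
  pdot n1 n1 = 1 -> pdot n2 n2 = 1 -> pdot n3 n3 = 1 ->
  pdot n2 n3 = - cos (k1%:R * (pi / q1%:R)) ->
  pdot n1 n3 = - cos (k2%:R * (pi / q2%:R)) ->
  pdot n1 n2 = - cos (k3%:R * (pi / q3%:R)) ->
  vol ([set p | 0 <= pdot n1 p] `&` [set p | 0 <= pdot n2 p] `&`
       [set p | 0 <= pdot n3 p]) =
  (k1%:R / q1%:R + k2%:R / q2%:R + k3%:R / q3%:R - 1) / 4 * vol [set: E4].
Proof.
move=> /andP[k10 kq1] /andP[k20 kq2] /andP[k30 kq3] u1 u2 u3 n23 n13 n12.
have := vol_wedge k10 kq1 u2 u3 n23.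
have := vol_wedge k20 kq2 u1 u3 n13.
have := vol_wedge k30 kq3 u1 u2 n12.
have := vol_halfspace u3.
set P1 := [set p | 0 <= pdot n1 p]; set P2 := [set p | 0 <= pdot n2 p].
set P3 := [set p | 0 <= pdot n3 p].
pose M1 := [set p | pdot n1 p <= 0]; pose M2 := [set p | pdot n2 p <= 0].
pose M3 := [set p | pdot n3 p <= 0].
have mP1 : measurable P1 by exact: measurable_pdot_ge0.
have mP2 : measurable P2 by exact: measurable_pdot_ge0.
have mP3 : measurable P3 by exact: measurable_pdot_ge0.
have mM1 : measurable M1 by exact: measurable_pdot_le0.
have mM2 : measurable M2 by exact: measurable_pdot_le0.
have mM3 : measurable M3 by exact: measurable_pdot_le0.
have -> : vol P3 = vol (P1 `&` P2 `&` P3) + vol (P1 `&` M2 `&` P3) +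
   (vol (M1 `&` P2 `&` P3) + vol (M1 `&` M2 `&` P3)).
  rewrite (vol_split u1 mP3) -/P1 -/M1.
  rewrite (vol_split u2 (measurableI _ _ mP3 mP1)) -/P2 -/M2.
  rewrite (vol_split u2 (measurableI _ _ mP3 mM1)) -/P2 -/M2.
  by rewrite -!setIA ![P3 `&` _]setIC -!setIA.
have -> : vol (P1 `&` P2) = vol (P1 `&` P2 `&` P3) + vol (P1 `&` P2 `&` M3).
  exact: vol_split u3 (measurableI _ _ mP1 mP2).
have -> : vol (P1 `&` P3) = vol (P1 `&` P2 `&` P3) + vol (P1 `&` M2 `&` P3).
  rewrite (vol_split u2 (measurableI _ _ mP1 mP3)) -/P2 -/M2.
  by rewrite -!setIA ![P3 `&` _]setIC.
have -> : vol (P2 `&` P3) = vol (P1 `&` P2 `&` P3) + vol (M1 `&` P2 `&` P3).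
  rewrite (vol_split u1 (measurableI _ _ mP2 mP3)) -/P1 -/M1.
  by congr (vol _ + vol _); rewrite setIC setIA.
have -> : vol (M1 `&` M2 `&` P3) = vol (P1 `&` P2 `&` M3).
  rewrite -(vol_opp (measurableI _ _ (measurableI _ _ mP1 mP2) mM3)).
  have E n p : pdot n (- p.1, (- p.2.1, (- p.2.2.1, - p.2.2.2))) = - pdot n p.
    by rewrite /pdot/=; ring.
  congr vol; apply/seteqP.
  by split => p; rewrite /P1 /P2 /M3 /= !E !oppr_ge0 oppr_le0.
set a := vol (_ `&` P3); set b := vol (_ `&` P3).
set c := vol (_ `&` M3); set d := vol (_ `&` P3); set v := vol setT.
have q10 : q1%:R != 0 :> R by rewrite pnatr_eq0 -lt0n (leq_trans _ kq1).
have q20 : q2%:R != 0 :> R by rewrite pnatr_eq0 -lt0n (leq_trans _ kq2).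
have q30 : q3%:R != 0 :> R by rewrite pnatr_eq0 -lt0n (leq_trans _ kq3).
move=> h0 h3 h2 h1.
have -> : a = ((a + c) + (a + b) + (a + d) - (a + b + (d + c))) / 2 by field.
rewrite h0 h1 h2 h3; field.
by rewrite q10 q20 q30.
Qed.

End girard.

(** * Indecomposability *)

Section dot_lemmas.
Context (R : realType) (d : nat).
Implicit Types (u v w : 'rV[R]_d) (a : R).

Lemma dotC u v : dot u v = dot v u.
Proof. by apply: eq_bigr => i _; rewrite mulrC. Qed.

Lemma dotDl u v w : dot (u + v) w = dot u w + dot v w.
Proof.
by rewrite /dot -big_split; apply: eq_bigr => i _; rewrite mxE mulrDl.
Qed.

Lemma dotZl a u v : dot (a *: u) v = a * dot u v.
Proof. by rewrite /dot mulr_sumr; apply: eq_bigr => i _; rewrite mxE mulrA. Qed.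

Lemma dotDr u v w : dot w (u + v) = dot w u + dot w v.
Proof. by rewrite dotC dotDl ![dot _ w]dotC. Qed.

Lemma dotZr a u v : dot u (a *: v) = a * dot u v.
Proof. by rewrite dotC dotZl dotC. Qed.

Lemma dot0l v : dot 0 v = 0.
Proof. by rewrite -(scale0r 0) dotZl mul0r. Qed.

Lemma dot_suml (I : finType) (F : I -> 'rV[R]_d) v :
  dot (\sum_i F i) v = \sum_i dot (F i) v.
Proof.
apply: (big_morph (fun u => dot u v)); last exact: dot0l.
by move=> x y; exact: dotDl.
Qed.

Lemma dot_ge0 u : 0 <= dot u u.
Proof. by apply: sumr_ge0 => i _; rewrite -expr2 sqr_ge0. Qed.

Lemma dot_eq0 u : (dot u u == 0) = (u == 0).
Proof.
apply/eqP/eqP => [|->]; last exact: dot0l.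
move=> /psumr_eq0P u0; apply/rowP => i; apply/eqP; rewrite mxE.
by rewrite -sqrf_eq0 expr2 u0// => j _; rewrite -expr2 sqr_ge0.
Qed.

Lemma dot_gt0 u : u != 0 -> 0 < dot u u.
Proof. by move=> u0; rewrite lt_neqAle dot_ge0 andbT eq_sym dot_eq0. Qed.

Lemma enorm_gt0 u : u != 0 -> 0 < enorm u.
Proof. by move=> u0; rewrite sqrtr_gt0 dot_gt0. Qed.

Lemma enorm_sqr u : enorm u ^+ 2 = dot u u.
Proof. by rewrite sqr_sqrtr// dot_ge0. Qed.

Lemma enormZ a u : 0 <= a -> enorm (a *: u) = a * enorm u.
Proof.
move=> a0; rewrite /enorm dotZl dotZr mulrA -expr2 sqrtrM ?sqr_ge0//.
by rewrite sqrtr_sqr ger0_norm.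
Qed.

Lemma cauchy_schwarz u v : dot u v ^+ 2 <= dot u u * dot v v.
Proof.
have [->|v0] := eqVneq v 0; first by rewrite dotC !dot0l expr0n mulr0.
have := dot_ge0 (dot v v *: u + (- dot u v) *: v).
rewrite !dotDl !dotDr !dotZl !dotZr [dot v u]dotC.
rewrite (_ : _ + _ = dot v v * (dot u u * dot v v - dot u v ^+ 2)); last by ring.
by rewrite pmulr_rge0 ?dot_gt0// subr_ge0.
Qed.

Lemma cos_angle u v : u != 0 -> v != 0 ->
  dot u v = cos (angle u v) * (enorm u * enorm v).
Proof.
move=> u0 v0.
have uv0 : 0 < enorm u * enorm v by rewrite mulr_gt0// enorm_gt0.
rewrite /angle acosK ?mulfVK ?gt_eqF//.
rewrite in_itv/= -ler_norml normrM normfV (gtr0_norm uv0) ler_pdivrMr// mul1r.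
rewrite -(@ler_pXn2r _ 2%N) ?nnegrE ?(ltW uv0)// real_normK ?num_real//.
by rewrite exprMn !enorm_sqr cauchy_schwarz.
Qed.

End dot_lemmas.

(** * Simplicial cones and their dual bases *)

Section dual_basis.
Context (R : realType).
Implicit Types (V W : 'M[R]_4) (u : 'rV[R]_4).

Lemma sum4 (X : zmodType) (i j k l : 'I_4) (F : 'I_4 -> X) :
  uniq [:: i; j; k; l] -> \sum_r F r = F i + (F j + (F k + F l)).
Proof.
move=> U; rewrite (perm_big [:: i; j; k; l]); last first.
  apply: uniq_perm => //; first exact: index_enum_uniq.
  move=> x; rewrite mem_index_enum; apply/esym.
  have U4 : #|[:: i; j; k; l]| = #|'I_4| by rewrite (card_uniqP U) card_ord.
  have /(_ x) := subset_cardP U4 (subset_predT _).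
  by rewrite inE => ->.
by rewrite !big_cons big_nil /= addr0.
Qed.

Lemma uniq4_complete (i j : 'I_4) : i != j ->
  exists k l : 'I_4, uniq [:: i; j; k; l].
Proof.
move=> ij; have : #|~: [set i; j]| == 2%N.
  by have := cardsC [set i; j]; rewrite cards2 ij card_ord /= => /eqP; rewrite -[4%N]/(2 + 2)%N eqn_add2l.
move=> /cards2P[k [l [kl E]]]; exists k, l.
have : k \in ~: [set i; j] by rewrite E !inE eqxx.
have : l \in ~: [set i; j] by rewrite E !inE eqxx orbT.
rewrite !inE !negb_or => /andP[li lj] /andP[ki kj] /=.
by rewrite !inE !negb_or ij kl ![i == _]eq_sym ![j == _]eq_sym li lj ki kj.
Qed.

Lemma dual_expansion V u : V \in unitmx ->
  u = \sum_r dot u (row r V) *: inner_normal V r.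
Proof.
move=> uV; rewrite -[LHS]mulmx1 -[1%:M]trmx1 -(mulVmx uV) trmx_mul mulmxA.
rewrite mulmx_sum_row; apply: eq_bigr => r _; congr (_ *: _).
by rewrite mxE; apply: eq_bigr => j _; rewrite !mxE.
Qed.

Lemma primal_expansion V u : V \in unitmx ->
  u = \sum_r dot u (inner_normal V r) *: row r V.
Proof.
move=> uV; rewrite -[LHS]mulmx1 -(mulVmx uV) mulmxA mulmx_sum_row.
apply: eq_bigr => r _; congr (_ *: _).
by rewrite mxE; apply: eq_bigr => j _; rewrite !mxE.
Qed.

Lemma coneE V u : V \in unitmx ->
  cone V u <-> forall r, 0 <= dot u (inner_normal V r).
Proof.
move=> uV; split.
  move=> [a [a0 ->]] r.
  rewrite mulmx_sum_row dot_suml (bigD1 r)//= big1 ?addr0.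
    by rewrite dotZl dot_inner_normal// eqxx mulr1.
  by move=> s sr; rewrite dotZl dot_inner_normal// (negbTE sr) mulr0.
move=> h; exists (\row_r dot u (inner_normal V r)); split => [i|]; first by rewrite mxE.
rewrite -[LHS]mulmx1 -(mulVmx uV) mulmxA; congr (_ *m _).
by apply/rowP => r; rewrite !mxE; apply: eq_bigr => j _; rewrite !mxE.
Qed.

Lemma row_neq0 V r : V \in unitmx -> row r V != 0.
Proof.
move=> uV; apply/eqP => r0; have := dot_inner_normal r r uV.
by rewrite r0 dot0l eqxx => /eqP; rewrite eq_sym oner_eq0.
Qed.

Lemma inner_normal_neq0 V r : V \in unitmx -> inner_normal V r != 0.
Proof.
move=> uV; apply/eqP => r0; have := dot_inner_normal r r uV.
by rewrite r0 dotC dot0l eqxx => /eqP; rewrite eq_sym oner_eq0.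
Qed.

Lemma cone_row V r : V \in unitmx -> cone V (row r V).
Proof. by move=> uV; apply/coneE => // s; rewrite dot_inner_normal. Qed.

Lemma coneZ V c u : 0 <= c -> cone V u -> cone V (c *: u).
Proof.
move=> c0 [a [a0 ->]]; exists (c *: a); rewrite scalemxAl; split => // i.
by rewrite mxE mulr_ge0.
Qed.

Lemma tetrahedron_normalize V u : u != 0 -> cone V u ->
  tetrahedron V ((enorm u)^-1 *: u).
Proof.
move=> u0 Vu; have n0 := enorm_gt0 u0.
split; first by apply: coneZ => //; rewrite invr_ge0 ltW.
by rewrite /sphere3/= enormZ ?invr_ge0 ?(ltW n0)// mulVf// gt_eqF.
Qed.

Lemma cone_normalize V u : u != 0 -> cone V ((enorm u)^-1 *: u) -> cone V u.
Proof.
move=> u0 Vu; have n0 := enorm_gt0 u0.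
by rewrite -[u](@scalerKV _ _ (enorm u)) ?gt_eqF//; apply: coneZ => //; exact: ltW.
Qed.

End dual_basis.

(** * Small dihedral angles of Coxeter cones *)

Section coxeter_cones.
Context (R : realType).

Lemma cos_pi_div3 : cos (pi / 3) = 2^-1 :> R.
Proof.
set c := cos _.
have c0 : 0 <= c.
  by apply: cos_ge0_pihalf; have := pi_gt0 R; move=> ?; apply/andP; split; lra.
(* The triple-angle formula at [cos pi = -1] reads 4 c^3 - 3 c + 1 = 0, and this is its
   factorization. *)
have E : (c + 1) * (2 * c - 1) ^+ 2 = 0.
  have : cos (pi / 3 + (pi / 3 + pi / 3)) = -1 :> R by rewrite -cospi; congr cos; field.
  rewrite cosD cosD sinD -/c; set s := sin _ => h.
  have s2 : s ^+ 2 = 1 - c ^+ 2 by exact: sin2cos2.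
  have : c * (c * c) - 3 * c * s ^+ 2 = -1 by rewrite -h; ring.
  by rewrite s2 => h'; apply: etrans (_ : c * (c * c) - 3 * c * (1 - c ^+ 2) + 1 = 0);
    [ring | rewrite h' addNr].
move/eqP: E; rewrite mulf_eq0 expf_eq0/= => /orP[|]/eqP ?; lra.
Qed.

Lemma cos_pi_div6 : cos (pi / 6) ^+ 2 = 3 / 4 :> R.
Proof.
have : cos (pi / 6 + pi / 6) = 2^-1 :> R by rewrite -cos_pi_div3; congr cos; field.
by rewrite cosD -!expr2 sin2cos2; lra.
Qed.

(** A Coxeter angle is pi / 2 or at most pi / 3; this gap turns a strict bound on the cosine into a
    right angle. *)
Lemma cos_pi_divn (n : nat) : (2 <= n)%N ->
  let c := cos (pi / n%:R) : R in 0 <= c /\ (c = 0 \/ 2^-1 <= c).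
Proof.
move=> n2 c; have pi0 := pi_gt0 R.
have [n2'|n3] : n = 2%N \/ (3 <= n)%N.
  by case: n n2 c => [|[|[|n]]]//; [left|right].
  by rewrite /c n2' cos_pihalf; split => //; left.
have n0 : 0 < n%:R :> R by rewrite ltr0n (leq_trans _ n3).
have c2 : 2^-1 <= c.
  rewrite -cos_pi_div3 leNgt ltr_cos ?in_itv/=.
  - by rewrite -leNgt ler_pM2l// lef_pV2 ?posrE// ler_nat.
  - by apply/andP; split; lra.
  - rewrite divr_ge0 ?(ltW pi0) ?(ltW n0)//= ler_pdivrMr// ler_peMr ?(ltW pi0)//.
    by rewrite (ler_nat _ 1) (leq_trans _ n3).
by split; [lra | right].
Qed.

(* With [p], [q], [g] the inner products of two vectors m, m', the inner products
   of a m + b m' and a' m + b' m' are [N], [N'], [I]: two vectors in the cone of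
   m and m' make an angle at most that of m and m'. *)
Lemma cone2_angle (p q g a b a' b' : R) :
  0 <= p -> 0 <= q -> g <= 0 -> g ^+ 2 <= p * q ->
  0 <= a -> 0 <= b -> 0 <= a' -> 0 <= b' -> a * b' - a' * b != 0 ->
  let I := a * a' * p + b * b' * q + g * (a * b' + a' * b) in
  let N := a * a * p + b * b * q + 2 * (a * b * g) in
  let N' := a' * a' * p + b' * b' * q + 2 * (a' * b' * g) in
  I <= 0 -> 3 * (N * N') <= 4 * I ^+ 2 -> 3 * (p * q) <= 4 * g ^+ 2.
Proof.
move=> p0 q0 g0 gpq a0 b0 a'0 b'0; set D := _ - _ => D0 I N N' I0 h.
(* The Gram determinant of the two combinations is [D ^+ 2] times that of the two original
   vectors. *)
have NN : N * N' = I ^+ 2 + D ^+ 2 * (p * q - g ^+ 2).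
  by rewrite /N /N' /I /D; ring.
suff ID : I ^+ 2 <= D ^+ 2 * g ^+ 2.
  have D2 : 0 < D ^+ 2 by rewrite lt_neqAle sqr_ge0 andbT eq_sym sqrf_eq0.
  by rewrite -(ler_pM2l D2); nra.
pose S := a * a' * p + b * b' * q.
have S0 : 0 <= S by rewrite /S addr_ge0// !mulr_ge0.
(* The inequality of arithmetic and geometric means for the two terms of [S]; it is applied to the
   smaller of [a * b'] and [a' * b]. *)
have H (m : R) : 0 <= m -> m ^+ 2 <= a * a' * b * b' -> 2 * (- g * m) <= S.
  move=> m0 hm; rewrite -(@ler_pXn2r _ 2%N) ?nnegrE ?mulr_ge0 ?oppr_ge0//.
  apply: (@le_trans _ _ (4 * (p * q) * (a * a' * b * b'))).
    rewrite (_ : _ ^+ 2 = 4 * (g ^+ 2 * m ^+ 2)); last by ring.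
    by rewrite -[4 * (p * q) * _]mulrA ler_pM2l// ler_pM ?sqr_ge0.
  rewrite -subr_ge0 (_ : _ - _ = (a * a' * p - b * b' * q) ^+ 2) ?sqr_ge0//.
  by rewrite /S; ring.
have ab0 : 0 <= a * b' by exact: mulr_ge0.
have ba0 : 0 <= a' * b by exact: mulr_ge0.
rewrite -[D ^+ 2]real_normK ?num_real// -[g ^+ 2]sqrrN -exprMn -[I ^+ 2]sqrrN.
rewrite ler_pXn2r ?nnegrE ?mulr_ge0 ?oppr_ge0//.
have [h1|h1] := leP (a' * b) (a * b').
  rewrite ger0_norm ?subr_ge0//.
  have : 2 * (- g * (a' * b)) <= S.
    apply: H => //; rewrite expr2 (_ : a * a' * b * b' = (a * b') * (a' * b)); last by ring.
    by rewrite ler_wpM2r.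
  by rewrite /S /I /D; lra.
rewrite ltr0_norm ?subr_lt0//.
have : 2 * (- g * (a * b')) <= S.
  apply: H => //; rewrite expr2 (_ : a * a' * b * b' = (a * b') * (a' * b)); last by ring.
  by rewrite ler_wpM2l// ltW.
by rewrite /S /I /D; lra.
Qed.

(** Otherwise the Gram determinant of the three unit vectors would be at most 0. The coefficients of
    [e] are cofactors: [e] is [1 - x ^+ 2] times the part of [u] orthogonal to [v] and [w], and its
    squared norm is [1 - x ^+ 2] times that determinant. So [e] vanishes, while its coefficient on
    [v] is positive. *)
Lemma gram3_right_angle d (u v w : 'rV[R]_d) (x y z : R) :
  dot u u = 1 -> dot v v = 1 -> dot w w = 1 ->
  dot u v = - y -> dot u w = - z -> dot v w = - x ->
  0 <= x -> 0 <= z -> 3 / 4 <= x ^+ 2 ->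
  (forall a b c, a *: u + b *: v + c *: w = 0 -> b = 0) -> y < 2^-1.
Proof.
move=> u1 v1 w1 uv uw vw x0 z0 x34 free; rewrite ltNge; apply/negP => y2.
pose e := (1 - x ^+ 2) *: u + (y + x * z) *: v + (z + x * y) *: w.
have ee : dot e e = (1 - x ^+ 2) * (1 - x ^+ 2 - y ^+ 2 - z ^+ 2 - 2 * (x * y * z)).
  rewrite /e !dotDl !dotZl !dotDr !dotZr u1 v1 w1 [dot v u]dotC [dot w _]dotC.
  by rewrite [dot w v]dotC uv uw vw; ring.
have x1 : x ^+ 2 <= 1 by have := cauchy_schwarz v w; rewrite vw v1 w1 sqrrN mulr1.
have xyz : 0 <= x * y * z by rewrite !mulr_ge0//; lra.
have e0 : e = 0.
  apply/eqP; rewrite -dot_eq0 eq_le dot_ge0 andbT ee mulr_ge0_le0 ?subr_ge0//.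
  have : 4^-1 <= y ^+ 2 by nra.
  by have := sqr_ge0 z; lra.
have := free _ _ _ e0; have := mulr_ge0 x0 z0; lra.
Qed.

Lemma coxeter_normals (W : 'M[R]_4) (r s : 'I_4) : coxeter W -> r != s ->
  exists c : R, [/\ 0 <= c, c = 0 \/ 2^-1 <= c &
    dot (inner_normal W r) (inner_normal W s) =
      - c * (enorm (inner_normal W r) * enorm (inner_normal W s))].
Proof.
move=> [uW /(_ r s) cW] /cW[n [n2 /eqP]].
rewrite /dihedral subr_eq addrC -subr_eq => /eqP angleE.
have [c0 c1] := cos_pi_divn n2.
exists (cos (pi / n%:R)); split => //.
rewrite cos_angle ?inner_normal_neq0// -angleE; congr (_ * _).
by rewrite cosB cospi sinpi; ring.
Qed.

Lemma coxeter_right_angle (W : 'M[R]_4) (r k l : 'I_4) :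
  coxeter W -> r != k -> r != l -> k != l ->
  let M := inner_normal W in
  3 * (dot (M k) (M k) * dot (M l) (M l)) <= 4 * dot (M k) (M l) ^+ 2 ->
  dot (M r) (M k) = 0.
Proof.
move=> cW rk rl kl M h; have uW := proj1 cW.
pose e s := enorm (M s).
have e0 s : 0 < e s by rewrite enorm_gt0// inner_normal_neq0.
pose U s := (e s)^-1 *: M s.
have U1 s : dot (U s) (U s) = 1.
  by rewrite dotZl dotZr -enorm_sqr -/(e s); field; rewrite gt_eqF.
have UU s t c : dot (M s) (M t) = - c * (e s * e t) -> dot (U s) (U t) = - c.
  by move=> E; rewrite dotZl dotZr E; field; rewrite !gt_eqF.
have [y [y0 y12 yE]] := coxeter_normals cW rk.
have [z [z0 _ zE]] := coxeter_normals cW rl.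
have [x [x0 _ xE]] := coxeter_normals cW kl.
have x34 : 3 / 4 <= x ^+ 2.
  move: h; rewrite -!enorm_sqr xE -/(M k) -/(M l) -/(e k) -/(e l).
  have ee : 0 < (e k * e l) ^+ 2 by rewrite exprn_gt0// mulr_gt0.
  rewrite -exprMn (_ : (- x * (e k * e l)) ^+ 2 = x ^+ 2 * (e k * e l) ^+ 2); last by ring.
  by rewrite mulrA ler_pM2r//; lra.
have y2 : y < 2^-1.
  apply: (gram3_right_angle (U1 r) (U1 k) (U1 l) (UU _ _ _ yE) (UU _ _ _ zE) (UU _ _ _ xE)) => //.
  move=> a b c /(congr1 (fun u => dot u (row k W))).
  rewrite dot0l !dotDl !dotZl ![dot _ (row k W)]dotC !dot_inner_normal//.
  rewrite eqxx [k == r]eq_sym (negbTE rk) (negbTE kl) !mulr0 add0r addr0 mulr1.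
  by move=> /eqP; rewrite mulf_eq0 invr_eq0 (gt_eqF (e0 k)) orbF => /eqP.
by case: y12 => [y12|]; [rewrite yE y12 oppr0 mul0r|lra].
Qed.

(* The points [row i V + t *: row j V] fill an edge of the tetrahedron, and one
   piece contains two of them. *)
Lemma not_coxeter_decomposable (V : 'M[R]_4) (i j k l : 'I_4) :
  V \in unitmx -> uniq [:: i; j; k; l] ->
  let N := inner_normal V in
  dot (N k) (N l) <= 0 ->
  3 * (dot (N k) (N k) * dot (N l) (N l)) <= 4 * dot (N k) (N l) ^+ 2 ->
  (forall r, 0 < dot (row r V) (row i V + row j V)) ->
  ~ coxeter_decomposable (tetrahedron V).
Proof.
move=> uV U N Nkl hN pos [m [W [cW TE _]]].
have : [/\ i != j, i != k & i != l] /\ [/\ j != k, j != l & k != l].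
  move: U; rewrite /= !inE !negb_or !andbT.
  by move=> /andP[/and3P[-> -> ->] /andP[/andP[-> ->] ->]].
move=> [[ij ik il] [jk jl kl]].
have subW q r : cone V (row r (W q)).
  have uW := proj1 (cW q); apply: cone_normalize; first exact: row_neq0.
  suff : tetrahedron V ((enorm (row r (W q)))^-1 *: row r (W q)) by case.
  rewrite TE; exists q => //; apply: tetrahedron_normalize; first exact: row_neq0.
  exact: cone_row.
pose P (t : R) := row i V + t *: row j V.
have PN t r : dot (P t) (N r) = (i == r)%:R + t * (j == r)%:R.
  by rewrite dotDl dotZl !dot_inner_normal.
have Pi t : dot (P t) (N i) = 1.
  by rewrite PN eqxx eq_sym (negbTE ij) mulr0 addr0.
have Pj t : dot (P t) (N j) = t.
  by rewrite PN eqxx (negbTE ij) mulr1 add0r.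
have Pk t : dot (P t) (N k) = 0.
  by rewrite PN (negbTE ik) (negbTE jk) mulr0 addr0.
have Pl t : dot (P t) (N l) = 0.
  by rewrite PN (negbTE il) (negbTE jl) mulr0 addr0.
have P0 t : P t != 0.
  by apply/eqP => p0; move: (Pi t); rewrite p0 dot0l => /eqP; rewrite eq_sym oner_eq0.
(* [m.+1] points of the edge for [m] pieces: two of them share a piece. *)
have cover (n : 'I_m.+1) : exists q, cone (W q) (P n%:R).
  have VP : cone V (P n%:R).
    by apply/coneE => // r; rewrite -/(N r) PN addr_ge0 ?mulr_ge0.
  have := tetrahedron_normalize (P0 _) VP; rewrite TE => -[q _ [h _]].
  by exists q; exact: cone_normalize h.
have [f fP] := choice cover.
have /injectivePn[n1 [n2 n12 fE]] : ~~ injectiveb f.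
  apply/negP => /injectiveP/leq_card; rewrite !card_ord ltnn.
  by [].
have := fP n1; have := fP n2; rewrite -fE.
have n12R : n1%:R != n2%:R :> R by rewrite eqr_nat.
move: (n1%:R) (n2%:R) n12R => s t st Wt Ws.
move: (f n1) (cW (f n1)) (subW (f n1)) Wt Ws => q.
move: (W q) => {W cW TE subW cover fE fP q f n1 n2 n12} W cW subW Wt Ws.
have uW := proj1 cW; pose M := inner_normal W.
have wN r e : 0 <= dot (row r W) (N e) by exact: (proj1 (coneE _ uV) (subW r)).
(* The facet of [V] normal to [N e] supports the cone of [W]: if it contains a point of that cone,
   it contains every vertex used with nonzero weight. *)
have face u e r : cone W u -> dot u (N e) = 0 -> dot u (M r) != 0 ->
    dot (row r W) (N e) = 0.
  move=> /(coneE _ uW) Wu + ur; rewrite {1}(primal_expansion u uW) dot_suml.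
  move/psumr_eq0P => /(_ _ r isT) H.
  have /eqP : dot (dot u (inner_normal W r) *: row r W) (N e) = 0.
    by apply: H => c _; rewrite dotZl mulr_ge0.
  by rewrite dotZl mulf_eq0 (negbTE ur)/= => /eqP.
have [i1 xi1] : exists i1, dot (P s) (M i1) != 0.
  apply: contrapT => /forallNP h; have := P0 s; rewrite (primal_expansion (P s) uW).
  by rewrite big1 ?eqxx// => r _; have /negP := h r; rewrite negbK => /eqP ->; rewrite scale0r.
(* [P s] and [P t] agree against [N i] and differ against [N j], so they cannot lie on a single
   ray. *)
have [i2 i12 xi2] : exists2 i2, i1 != i2 & (dot (P s) (M i2) != 0) || (dot (P t) (M i2) != 0).
  apply: contrapT => h.
  have E u : u = P s \/ u = P t -> u = dot u (M i1) *: row i1 W.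
    move=> hu; rewrite {1}(primal_expansion u uW) (bigD1 i1)//= big1 ?addr0// => r ri.
    suff -> : dot u (inner_normal W r) = 0 by rewrite scale0r.
    apply/eqP/negPn/negP => ur; apply: h; exists r; first by rewrite eq_sym.
    by case: hu ur => -> ->; rewrite ?orbT.
  have Es := E _ (or_introl erefl); have Et := E _ (or_intror erefl).
  have wi : dot (row i1 W) (N i) != 0.
    by apply/eqP => w0; have := Pi s; rewrite Es dotZl w0 mulr0 => /eqP; rewrite eq_sym oner_eq0.
  have ab : dot (P s) (M i1) = dot (P t) (M i1).
    by apply: (mulIf wi); rewrite -!dotZl -Es -Et !Pi.
  by move/eqP: st; apply; rewrite -(Pj s) -(Pj t) Es ab -Et.
have Sw e : e \in [:: k; l] -> dot (row i1 W) (N e) = 0 /\ dot (row i2 W) (N e) = 0.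
  rewrite !inE => ekl.
  have Pe u : dot (P u) (N e) = 0 by case/orP: ekl => /eqP ->.
  split; first exact: (face (P s)).
  by case/orP: xi2 => ?; [exact: (face (P s))|exact: (face (P t))].
have [k' [l' U']] := uniq4_complete i12.
have : [/\ i1 != k', i1 != l', i2 != k', i2 != l' & k' != l'].
  move: U'; rewrite /= !inE !negb_or !andbT.
  by move=> /andP[/and3P[_ -> ->] /andP[/andP[-> ->] ->]].
move=> [ik' il' jk' jl' kl'].
(* Rows [i1] and [i2] of [W] span the plane of the edge, so the normals of [V] along that edge
   combine those of [W]. By [wN] the coefficients are nonnegative, as [cone2_angle] requires. *)
have NE e : e \in [:: k; l] ->
    N e = dot (row k' W) (N e) *: M k' + dot (row l' W) (N e) *: M l'.
  move=> /Sw[w1 w2]; rewrite {1}(dual_expansion (N e) uW) (sum4 _ U').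
  by rewrite ![dot (N e) _]dotC w1 w2 !scale0r !add0r.
have NkE := NE k (mem_head _ _); have NlE := NE l (mem_last k [:: l]).
set a := dot (row k' W) (N k) in NkE; set b := dot (row l' W) (N k) in NkE.
set a' := dot (row k' W) (N l) in NlE; set b' := dot (row l' W) (N l) in NlE.
have D0 : a * b' - a' * b != 0.
  apply/eqP => D.
  have E1 : b' *: N k - b *: N l = 0.
    rewrite NkE NlE !scalerDr !scalerA opprD addrACA -!scalerBl.
    by rewrite [b' * a]mulrC [b * a']mulrC D scale0r [b' * b]mulrC subrr scale0r addr0.
  have E2 : a' *: N k - a *: N l = 0.
    rewrite NkE NlE !scalerDr !scalerA opprD addrACA -!scalerBl.
    by rewrite [a' * a]mulrC subrr scale0r add0r -[_ - _]opprB D oppr0 scale0r.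
  have kk : dot (N k) (row k V) = 1 by rewrite dotC dot_inner_normal// eqxx.
  have lk : dot (N l) (row k V) = 0 by rewrite dotC dot_inner_normal// (negbTE kl).
  have b'0 : b' = 0.
    have := congr1 (fun u => dot u (row k V)) E1.
    by rewrite /= -scaleNr dotDl !dotZl kk lk dot0l mulr1 mulr0 addr0.
  have a'0 : a' = 0.
    have := congr1 (fun u => dot u (row k V)) E2.
    by rewrite /= -scaleNr dotDl !dotZl kk lk dot0l mulr1 mulr0 addr0.
  have := inner_normal_neq0 l uV; rewrite -/(N l) NlE a'0 b'0 !scale0r addr0.
  by rewrite eqxx.
have angleM : 3 * (dot (M k') (M k') * dot (M l') (M l')) <= 4 * dot (M k') (M l') ^+ 2.
  have [c [c0 _ gE]] := coxeter_normals cW kl'.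
  apply: (@cone2_angle _ _ _ a b a' b'); rewrite ?dot_ge0 ?wN ?cauchy_schwarz//.
  - by rewrite /M gE mulNr oppr_le0 !mulr_ge0// sqrtr_ge0.
  - move: Nkl; rewrite NkE NlE !dotDl !dotZl !dotDr !dotZr [dot (M l') (M k')]dotC.
    by congr (_ <= _); ring.
  - move: hN; rewrite NkE NlE !dotDl !dotZl !dotDr !dotZr [dot (M l') (M k')]dotC.
    by congr (_ <= _); ring.
have angleM' : 3 * (dot (M l') (M l') * dot (M k') (M k')) <= 4 * dot (M l') (M k') ^+ 2.
  by rewrite [dot (M l') (M k')]dotC [_ * dot (M k') _]mulrC.
have orth r : r \in [:: i1; i2] -> dot (M r) (M k') = 0 /\ dot (M r) (M l') = 0.
  rewrite !inE => hr.
  have rk : r != k' by case/orP: hr => /eqP ->.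
  have rl : r != l' by case/orP: hr => /eqP ->.
  by split; apply: coxeter_right_angle angleM' || apply: coxeter_right_angle angleM;
    rewrite // eq_sym.
have [p1k p1l] := orth i1 (mem_head _ _); have [p2k p2l] := orth i2 (mem_last i1 [:: i2]).
pose w := row k' W.
have wM r : dot w (M r) = (k' == r)%:R by exact: dot_inner_normal.
(* By [orth], the span of [M i1] and [M i2] is orthogonal to that of [M k'] and [M l']. The
   component [w'] of [w] in the first span vanishes, because [w] is orthogonal to both [M i1] and
   [M i2]. *)
pose w' := dot w (row i1 W) *: M i1 + dot w (row i2 W) *: M i2.
have w'0 : w' = 0.
  apply/eqP; rewrite -dot_eq0; apply/eqP.
  have ww' : dot w w' = 0.
    rewrite dotDr !dotZr !wM ![k' == _]eq_sym (negbTE ik') (negbTE jk').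
    by rewrite !mulr0 addr0.
  have wE : w = w' + (dot w (row k' W) *: M k' + dot w (row l' W) *: M l').
    by rewrite {1}(dual_expansion w uW) (sum4 _ U') addrA.
  have : dot w w' = dot w' w'.
    rewrite {1}wE dotDl [X in _ + X](_ : _ = 0) ?addr0//.
    rewrite dotDl !dotDr !dotZl !dotZr.
    by rewrite ![dot (M k') _]dotC ![dot (M l') _]dotC p1k p1l p2k p2l !mulr0 !addr0.
  by rewrite ww' => <-.
have wi1 : dot w (row i1 W) = 0.
  have := congr1 (fun u => dot u (row i1 W)) w'0.
  rewrite /= dot0l dotDl !dotZl ![dot (M _) (row i1 W)]dotC !dot_inner_normal//.
  by rewrite eqxx (negbTE i12) mulr1 mulr0 addr0.
have wi2 : dot w (row i2 W) = 0.
  have := congr1 (fun u => dot u (row i2 W)) w'0.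
  rewrite /= dot0l dotDl !dotZl ![dot (M _) (row i2 W)]dotC !dot_inner_normal//.
  by rewrite eqxx eq_sym (negbTE i12) mulr1 mulr0 add0r.
(* A nonzero weight of [P u] on row [k'] or [l'] would put that row in both facets, making a column
   of the determinant in [D0] vanish. *)
have w_perp u : cone W (P u) -> dot w (P u) = 0.
  move=> WP; have z r : r \in [:: k'; l'] -> dot (P u) (M r) = 0.
    rewrite !inE => hr; apply/eqP/negPn/negP => ur.
    have hk := face _ k _ WP (Pk u) ur; have hl := face _ l _ WP (Pl u) ur.
    move/eqP: D0; apply; rewrite /a /b /a' /b'.
    by case/orP: hr hk hl => /eqP -> -> ->; rewrite ?mulr0 ?mul0r subrr.
  rewrite (primal_expansion (P u) uW) (sum4 _ U') -/M (z k') ?(z l') ?inE ?eqxx ?orbT//.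
  by rewrite !scale0r !addr0 dotDr !dotZr wi1 wi2 !mulr0 addr0.
have wj : dot w (row j V) = 0.
  have := w_perp _ Ws; rewrite -[RHS](w_perp _ Wt) /P !dotDr !dotZr => /addrI/eqP.
  by rewrite -subr_eq0 -mulrBl mulf_eq0 subr_eq0 (negbTE st) => /eqP.
have wi : dot w (row i V) = 0.
  by have := w_perp _ Ws; rewrite /P dotDr dotZr wj mulr0 addr0.
(* But [w] is a nonzero nonnegative combination of the rows of [V], all of which have positive
   product with this sum. *)
have : dot w (row i V + row j V) = 0 by rewrite dotDr wi wj addr0.
rewrite {1}(primal_expansion w uV) dot_suml => /psumr_eq0P w0.
have := row_neq0 k' uW; rewrite -/w (primal_expansion w uV) big1 ?eqxx// => r _.
have /eqP : dot (dot w (inner_normal V r) *: row r V) (row i V + row j V) = 0.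
  by apply: w0 => // c _; rewrite dotZl mulr_ge0 ?wN// ltW.
by rewrite dotZl mulf_eq0 (gt_eqF (pos r)) orbF => /eqP ->; rewrite scale0r.
Qed.

End coxeter_cones.

(** * The example *)

Section volume_of_tetrahedron.
Context (R : realType).

Local Notation RR := (measurableTypeR R).
Local Notation E4 := (RR * (RR * (RR * RR)))%type.

Lemma pdot_pack4 (u v : 'rV[R]_4) : pdot (pack4 u) (pack4 v) = dot u v.
Proof.
rewrite /dot !big_ord_recl big_ord0 addr0 /pdot/= -!addrA.
have E (k : 'I_4) (m : nat) : m = k -> inord m = k :> 'I_4.
  by move=> ->; exact: inord_val.
by rewrite (E ord0)// (E (lift ord0 ord0))// (E (lift ord0 (lift ord0 ord0)))//
  (E (lift ord0 (lift ord0 (lift ord0 ord0)))).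
Qed.

Definition unpack4 (p : E4) : 'rV[R]_4 :=
  \row_i nth 0 [:: p.1; p.2.1; p.2.2.1; p.2.2.2] i.

Lemma unpack4K : cancel unpack4 (@pack4 R : _ -> E4).
Proof. by move=> [x [y [z w]]]; rewrite /pack4 !mxE !inordK. Qed.

Definition normal_halfspace (V : 'M[R]_4) (r : 'I_4) : set E4 :=
  [set p | 0 <= pdot (pack4 (inner_normal V r) : E4) p].

(** Polar coordinates: the solid sector is the part of the cone in the unit ball. *)
Lemma pack4_sector (V : 'M[R]_4) : V \in unitmx ->
  pack4 @` sector (tetrahedron V) =
  (\bigcap_(r in [set: 'I_4]) normal_halfspace V r) `&` @ball4 R.
Proof.
move=> uV; apply/seteqP; split => p.
  move=> [_ [r [u [r0 r1 [Vu u1] ->]] <-]]; split.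
    move=> i _; rewrite /normal_halfspace/= pdot_pack4 dotC.
    by rewrite dotZl mulr_ge0//; exact: (proj1 (coneE u uV)).
  rewrite /ball4/= pdot_pack4 dotZl dotZr -enorm_sqr u1 expr1n mulr1.
  by rewrite mulr_ile1.
move=> [pV pB]; pose x := unpack4 p; have px : p = pack4 x by rewrite unpack4K.
have Vx : cone V x.
  apply/coneE => // r; have := pV r I.
  by rewrite /normal_halfspace/= px pdot_pack4 dotC.
(* The apex has no direction; any point of the tetrahedron, scaled by radius 0, serves. *)
have [x0|x0] := eqVneq x 0.
  exists x => //; exists 0, ((enorm (row 0 V))^-1 *: row 0 V).
  split; rewrite ?ler01//; last by rewrite scale0r.
  by apply: tetrahedron_normalize; [exact: row_neq0|exact: cone_row].
exists x => //; exists (enorm x), ((enorm x)^-1 *: x); split.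
- exact: sqrtr_ge0.
- rewrite -(@ler_pXn2r _ 2%N) ?nnegrE ?sqrtr_ge0// enorm_sqr expr1n.
  by rewrite -pdot_pack4 -px.
- exact: tetrahedron_normalize.
- by rewrite scalerA divff ?scale1r// gt_eqF// enorm_gt0.
Qed.

Lemma sphere_vol_tetrahedron (V : 'M[R]_4) : V \in unitmx ->
  sphere_vol (tetrahedron V) =
  (4 * vol (\bigcap_(r in [set: 'I_4]) normal_halfspace V r))%:E.
Proof.
move=> uV; rewrite /sphere_vol pack4_sector//.
set C := \bigcap_(_ in _) _.
have mC : measurable C.
  apply: fin_bigcap_measurable => // r _; exact: measurable_pdot_ge0.
rewrite unlock EFinM; congr (_ * _)%E; rewrite fineK//.
exact: leb4_ball_fin.
Qed.

Lemma vol_reflection_symmetric (n : E4) (A : set E4) :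
  pdot n n = 1 -> measurable A -> reflect n @^-1` A = A ->
  vol (A `&` [set p | 0 <= pdot n p]) = vol A / 2.
Proof.
move=> n1 mA An; set H := [set p | _].
have mH : measurable H by exact: measurable_pdot_ge0.
have -> : vol A = vol (A `&` H) + vol (A `&` H); last by field.
rewrite {1}(vol_split n1 mA); congr (_ + _).
rewrite -(vol_reflect n1 (measurableI _ _ mA mH)); congr vol.
rewrite preimage_setI An; congr (_ `&` _); apply/seteqP.
by split => p; rewrite /H/= pdot_reflect n1; lra.
Qed.

End volume_of_tetrahedron.

(** * The tetrahedron with angles pi / 6, 2 pi / 5 and four right angles *)

Section example.
Context (R : realType).

Local Notation RR := (measurableTypeR R).
Local Notation E4 := (RR * (RR * (RR * RR)))%type.

Let h : R := cos (pi / 6).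
Let g : R := cos (2 * (pi / 5)).
(** Makes the third normal [(- h, - g, s, 0)] a unit vector. The radicand is positive because
    [h ^+ 2 = 3 / 4] and [g < 1 / 2], that is, 2 pi / 5 > pi / 3. *)
Let s : R := Num.sqrt (1 - h ^+ 2 - g ^+ 2).

Let pi0 : 0 < pi :> R := pi_gt0 R.

Let h2 : h ^+ 2 = 3 / 4. Proof. exact: cos_pi_div6. Qed.

Let h0 : 0 < h.
Proof. by apply: cos_gt0_pihalf; apply/andP; split; move: pi0; lra. Qed.

Let g0 : 0 < g.
Proof. by apply: cos_gt0_pihalf; apply/andP; split; move: pi0; lra. Qed.

Let g12 : g < 2^-1.
Proof.
rewrite -cos_pi_div3 ltr_cos ?in_itv/=; first by move: pi0; lra.
all: by apply/andP; split; move: pi0; lra.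
Qed.

Let s0 : 0 < s.
Proof. by rewrite sqrtr_gt0 h2; have := g0; have := g12; nra. Qed.

Let s2 : s ^+ 2 = 1 - h ^+ 2 - g ^+ 2.
Proof. by rewrite sqr_sqrtr// h2; have := g0; have := g12; nra. Qed.

Let mx_of (rows : seq (seq R)) : 'M[R]_4 :=
  \matrix_(i, j) nth 0 (nth [::] rows i) j.

(* The last coordinate direction joined with the spherical triangle of angles
   [2 * pi / 5], [pi / 6], [pi / 2] at its vertices given by the rows 0, 1, 2. *)
Definition example_tetrahedron : 'M[R]_4 := mx_of
  [:: [:: 1; 0; h / s; 0]; [:: 0; 1; g / s; 0];
      [:: 0; 0; s^-1; 0]; [:: 0; 0; 0; 1]].

Definition example_normals : 'M[R]_4 := mx_of
  [:: [:: 1; 0; 0; 0]; [:: 0; 1; 0; 0]; [:: - h; - g; s; 0]; [:: 0; 0; 0; 1]].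

Local Notation V := example_tetrahedron.
Local Notation N := example_normals.

Let VN : V *m N^T = 1%:M.
Proof.
have sn : s != 0 by rewrite gt_eqF.
apply/matrixP => i j; rewrite !mxE !big_ord_recl big_ord0 !mxE /=.
by case: i => [[|[|[|[|//]]]] ?]; case: j => [[|[|[|[|//]]]] ?] /=; field.
Qed.

Lemma example_unitmx : V \in unitmx.
Proof. by have [] := mulmx1_unit VN. Qed.

Lemma example_inner_normal r : inner_normal V r = row r N.
Proof.
rewrite /inner_normal -[in RHS](trmxK N); congr (row r _^T).
by rewrite -[LHS]mulmx1 -VN mulKmx// example_unitmx.
Qed.

Let dotN (i j : 'I_4) : dot (inner_normal V i) (inner_normal V j) =
  nth 0 (nth [::] [:: [:: 1; 0; - h; 0]; [:: 0; 1; - g; 0];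
                      [:: - h; - g; 1; 0]; [:: 0; 0; 0; 1]] i) j.
Proof.
have s2' : s * s = 1 - h ^+ 2 - g ^+ 2 by rewrite -expr2.
rewrite !example_inner_normal /dot !big_ord_recl big_ord0 !mxE /=.
by case: i => [[|[|[|[|//]]]] ?]; case: j => [[|[|[|[|//]]]] ?] /=; rewrite ?s2'; ring.
Qed.

Lemma dihedral_of_dot (W : 'M[R]_4) (i j : 'I_4) (t : R) :
  0 <= t <= pi -> dot (inner_normal W i) (inner_normal W i) = 1 ->
  dot (inner_normal W j) (inner_normal W j) = 1 ->
  dot (inner_normal W i) (inner_normal W j) = - cos t -> dihedral W i j = t.
Proof.
move=> tpi i1 j1 ij; rewrite /dihedral /angle /enorm i1 j1 ij sqrtr1 mulr1 divr1.
by rewrite acosN ?cos_geN1 ?cos_le1// cosK ?in_itv//=; ring.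
Qed.

Lemma example_rational_angles : rational_angles V.
Proof.
have N1 (i : 'I_4) : dot (inner_normal V i) (inner_normal V i) = 1.
  by rewrite dotN; case: i => [[|[|[|[|//]]]] ?].
move=> i j ij.
suff: exists q : rat, 0 <= (ratr q * pi : R) <= pi /\
    dot (inner_normal V i) (inner_normal V j) = - cos (ratr q * pi).
  by move=> [q [q01 qE]]; exists q; exact: dihedral_of_dot.
have Q2 : ratr (1 / 2) * pi = pi / 2 :> R.
  by rewrite fmorph_div/= rmorph1 ratr_nat; field.
have Q6 : ratr (1 / 6) * pi = pi / 6 :> R.
  by rewrite fmorph_div/= rmorph1 ratr_nat; field.
have Q5 : ratr (2 / 5) * pi = 2 * (pi / 5) :> R.
  by rewrite fmorph_div/= !ratr_nat; field.
have E2 : exists q : rat, 0 <= (ratr q * pi : R) <= pi /\ 0 = - cos (ratr q * pi) :> R.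
  exists (1 / 2); rewrite Q2 cos_pihalf oppr0; split => //.
  by apply/andP; split; move: pi0; lra.
have E6 : exists q : rat, 0 <= (ratr q * pi : R) <= pi /\ - h = - cos (ratr q * pi).
  by exists (1 / 6); rewrite Q6; split => //; apply/andP; split; move: pi0; lra.
have E5 : exists q : rat, 0 <= (ratr q * pi : R) <= pi /\ - g = - cos (ratr q * pi).
  by exists (2 / 5); rewrite Q5; split => //; apply/andP; split; move: pi0; lra.
rewrite dotN; case: i ij => [[|[|[|[|//]]]] ?]; case: j => [[|[|[|[|//]]]] ?] //= _;
  by [].
Qed.

Lemma example_not_decomposable : ~ coxeter_decomposable (tetrahedron V).
Proof.
pose o (k : nat) (h : (k < 4)%N) := Ordinal h.
(* Rows 3 and 1 are e and A; normals 2 and 0 bound the edge eA, with angle pi / 6. *)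
apply (@not_coxeter_decomposable R V (@o 3 isT) (@o 1 isT) (@o 2 isT) (@o 0 isT)) => //.
- exact: example_unitmx.
- by rewrite dotN/= oppr_le0 ltW.
- by rewrite !dotN/= sqrrN h2; lra.
move=> r; rewrite /dot !big_ord_recl big_ord0 !mxE /=.
have is0 : 0 < s^-1 by rewrite invr_gt0.
have gs : 0 < g / s * s^-1 by rewrite !mulr_gt0.
have gg : 0 <= g / s * (g / s) by rewrite !mulr_ge0// ltW// invr_gt0.
have hg : 0 < h / s * (g / s) by rewrite !mulr_gt0.
by case: r => [[|[|[|[|//]]]] ?] /=; lra.
Qed.

Lemma example_volume :
  sphere_vol (tetrahedron V) = (ratr (1 / 60) * pi ^+ 2)%:E.
Proof.
rewrite (sphere_vol_tetrahedron example_unitmx); congr EFin.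
pose o (k : nat) (h : (k < 4)%N) := Ordinal h.
pose n k : E4 := pack4 (inner_normal V k).
pose H k := [set p | 0 <= pdot (n k) p].
have nn i j : pdot (n i) (n j) = dot (inner_normal V i) (inner_normal V j).
  exact: pdot_pack4.
have mH k : measurable (H k) by exact: measurable_pdot_ge0.
pose D := H (@o 0 isT) `&` H (@o 1 isT) `&` H (@o 2 isT).
have mD : measurable D by apply: measurableI => //; exact: measurableI.
have -> : \bigcap_(r in [set: 'I_4]) normal_halfspace V r = D `&` H (@o 3 isT).
  apply/seteqP; split => [p pV|p [[[p0 p1] p2] p3] [[|[|[|[|//]]]] ri] _].
    by split; [split; [split|]|]; exact: pV.
  - by rewrite (_ : Ordinal ri = @o 0 isT)//; exact: val_inj.
  - by rewrite (_ : Ordinal ri = @o 1 isT)//; exact: val_inj.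
  - by rewrite (_ : Ordinal ri = @o 2 isT)//; exact: val_inj.
  - by rewrite (_ : Ordinal ri = @o 3 isT)//; exact: val_inj.
(* [D] does not involve the direction of e, so it is symmetric in the hyperplane polar to e. *)
have -> : vol (D `&` H (@o 3 isT)) = vol D / 2.
  apply: vol_reflection_symmetric => //; first by rewrite nn dotN.
  have E k p : val k != 3 -> pdot (n k) (reflect (n (@o 3 isT)) p) = pdot (n k) p.
    move=> k3; rewrite pdot_reflect nn dotN.
    by case: k k3 => [[|[|[|[|//]]]] ?]//= _; rewrite mulr0 subr0.
  by apply/seteqP; split => p; rewrite /D /H/= !E.
rewrite (@vol_girard _ _ _ _ 2 1 1 5 6 2) ?nn ?dotN//=; last 2 first.
- by rewrite mul1r.
- by rewrite mul1r cos_pihalf oppr0.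
(* The angle excess 2/5 + 1/6 + 1/2 - 1 is 1/15; dividing by 4, halving for e, and multiplying by 4
   and by the ball volume pi^2 / 2 gives pi^2 / 60. *)
by rewrite volT fmorph_div/= rmorph1 ratr_nat; field.
Qed.

End example.

Theorem theorem1p5 (R : realType) :
  exists V : 'M[R]_4,
    [/\ V \in unitmx,
        rational_angles V,
        exists q : rat, sphere_vol (tetrahedron V) = (ratr q * pi ^+ 2)%:E &
        ~ coxeter_decomposable (tetrahedron V)].
Proof.
exists (example_tetrahedron R); split.
- exact: example_unitmx.
- exact: example_rational_angles.
- by exists (1 / 60); exact: example_volume.
- exact: example_not_decomposable.
Qed.
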